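(* Consider the smooth stochastic $N$-player game and the RSG scheme with biased gradient estimators, as described in the context. Suppose that the stepsizes $\{\gamma_k\}_{k\ge0}$ are chosen such that $0<\gamma_k\le 1/(2L)$ for all $k\ge 0$, and the probability mass function $P_R$ is chosen such that for any $k=1,\dots,T$, $$P_R(k)=\mathrm{Prob}\{R=k\}=\frac{\gamma_k-L\gamma_k^2}{\sum_{j=1}^T(\gamma_j-L\gamma_j^2)}.$$ Suppose that Assumption B (see context) holds. Let $D=\left[(P_{\max}-P_{\min})/L\right]^{1/2}$. Then: (i) For any $T\ge1$ and any $c>0$, $$\mathbb{E}\left[\|\tilde G_{\gamma_R}(x^R,\xi^R)\|^2\right]\le\frac{2LD^2+(2+c^2)N\sum_{k=1}^T\gamma_k\left((\sigma_k^2+(S_k-1)\mu_k^2)/S_k\right)}{2\sum_{k=1}^T(\gamma_k-L\gamma_k^2)}+\frac1{c^2}\mathbb{E}\left[\|G_{\gamma_R}(x^R)\|^2\right].$$ (ii) Suppose that we choose the stepsizes $\gamma_k=1/(2L)$ and $P_R(k)=1/T$ for all $k=1,\dots,T$. Assume that $\sigma_k\le\sigma$ for some $\sigma>0$ for all $k$. Let a sufficiently large but fixed total number $M$ of calls to the stochastic first-order oracle be given. If the number of samples $S_k$ at iteration $k$ is $S_k=S=\left\lceil\frac{\sigma\sqrt{6M}}{4LD}\right\rceil$, then $$\mathbb{E}\left[\|G_{\gamma_R}(x^R)\|^2\right]\le\frac{16L^2D^2N}{(1-2/c^2)M}+\frac{\frac43\sqrt6(9+2c^2)L^2D^2N\sigma+\sqrt6(3+c^2)N^2\sigma\sum_{k=1}^T\mu_k^2}{(1-2/c^2)LD\sqrt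 M}$$ for any $c>\sqrt2$. In particular, if we take $c=\sqrt3$, then $$\mathbb{E}\left[\|G_{\gamma_R}(x^R)\|^2\right]\le\frac{48L^2D^2N}{M}+\frac{60\sqrt6L^2D^2N\sigma+18\sqrt6N^2\sigma\sum_{k=1}^T\mu_k^2}{LD\sqrt M}.$$
   Context: Game. There are $N$ players, $[N]=\{1,\dots,N\}$. Each $X_i\subseteq\mathbb{R}^{n_i}$ is closed and convex, $X=\prod_{i=1}^N X_i\subseteq\mathbb{R}^n$, $n=\sum_i n_i$; $x=(x_i)_{i=1}^N$ and $x_{-i}=(x_j)_{j\ne i}\in X_{-i}=\prod_{j\ne i}X_j$. Given $x_{-i}$, player $i$ solves $\min_{x_i\in X_i} f_i(x_i,x_{-i})=\mathbb{E}[\tilde f_i(x_i,x_{-i},\xi)]$, where $\xi$ is a random vector and each $\tilde f_i(\cdot,x_{-i},\xi)$ is smooth (possibly nonconvex) for any $x_{-i}$ and $\xi$. A function $P:X\to\mathbb{R}$ is a potential function of the game if $P(x_i^1,x_{-i})-P(x_i^2,x_{-i})=f_i(x_i^1,x_{-i})-f_i(x_i^2,x_{-i})$ for all $i\in[N]$, $x_i^1,x_i^2\in X_i$, $x_{-i}\in X_{-i}$. ''$L$-smooth'' means continuously differentiable with $L$-Lipschitz gradient. $\Pi_X$ is Euclidean projection onto $X$. Assumption B. (B1) The game admits an $L$-smooth potential function $P$ attaining its maximum $P_{\max}$ and minimum $P_{\min}$ over $X$. (B2) For any iterate $x^k$, $\|\mathbb{E}[\nabla_{x_i}\tilde f_i(x^k_i,x^k_{-i},\xi)-\nabla_{x_i}f_i(x^k_i,x^k_{-i})\mid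 x^k]\|\le\mu_k$ for some $\mu_k>0$ and any $i\in[N]$. (B3) For any $x^k$, $\mathbb{E}[\|\nabla_{x_i}\tilde f_i(x^k_i,x^k_{-i},\xi)-\nabla_{x_i}f_i(x^k_i,x^k_{-i})\|^2\mid x^k]\le\sigma_k^2$ for some $\sigma_k>0$ and any $i\in[N]$. (Thus the sampled gradients $\nabla_{x_i}\tilde f_i(\cdot,\xi)$ are allowed to be biased estimators of $\nabla_{x_i}f_i$.) RSG scheme. Inputs: starting point $x^0\in X$, iteration limit $T$, stepsizes $\{\gamma_k\}_{k\ge0}$, batch sizes $\{S_k\}_{k\ge0}$, and a probability mass function $P_R$ supported on $\{1,\dots,T\}$. Let $R$ be a random variable with probability mass function $P_R$. For $k=0,1,\dots,R-1$ and each $i\in[N]$: pick $S_k$ i.i.d. realizations $\{\xi^k_{i,l}\}_{l=1}^{S_k}$ of $\xi$, set $\tilde g_i(x^k,\xi_i^k)=\frac1{S_k}\sum_{l=1}^{S_k}\nabla_{x_i}\tilde f_i(x^k_i,x^k_{-i},\xi^k_{i,l})$, and update $x_i^{k+1}=\Pi_{X_i}[x_i^k-\gamma_k\tilde g_i(x^k,\xi_i^k)]$. Output $x^R$. Here $\xi^k$ denotes all samples of iteration $k$. One call to the stochastic first-order oracle returns one sampled gradient for one player, so iteration $k$ uses $NS_k$ calls. Expectations are taken over $R$ and the samples. Residuals. With $F(x)=(\nabla_{x_i}f_i(x))_{i=1}^N$ and $\tilde F(x^k,\xi^k)=(\tilde g_i(x^k,\xi_i^k))_{i=1}^N$, $$G_{\gamma_k}(x^k)=\tfrac1{\gamma_k}(x^k-\Pi_X[x^k-\gamma_kF(x^k)]),\qquad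 \tilde G_{\gamma_k}(x^k,\xi^k)=\tfrac1{\gamma_k}(x^k-\Pi_X[x^k-\gamma_k\tilde F(x^k,\xi^k)]).$$ *)

(* Defs.v *)
From HB Require Import structures.
From mathcomp Require Import all_boot all_order all_algebra.
From mathcomp Require Import all_classical all_reals all_analysis.

Set Implicit Arguments.
Unset Strict Implicit.
Unset Printing Implicit Defensive.

Import Order.TTheory GRing.Theory Num.Theory numFieldNormedType.Exports.

Local Open Scope classical_set_scope.
Local Open Scope ring_scope.

(* R^m with its Borel sigma-algebra; convertible to 'rV[R]_m, on which the
   library puts a topology but no sigma-algebra. *)
Notation borel_rV R m := (g_sigma_algebraType (@open 'rV[R]_m)).

Section Euclidean.
Context {R : realType} {m : nat}.
Implicit Types (A : set 'rV[R]_m) (f : 'rV[R]_m -> R).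

(* The library norm `|x| of a row vector is the max norm. *)
Definition enorm (x : 'rV[R]_m) : R := Num.sqrt (\sum_j x 0 j ^+ 2).

(* The default value returned by [get] is irrelevant when A is nonempty, closed
   and convex. *)
Definition eproj A (y : 'rV[R]_m) : 'rV[R]_m :=
  get [set z | A z /\ forall w, A w -> enorm (y - z) <= enorm (y - w)].

Definition grad f (x : 'rV[R]_m) : 'rV[R]_m := \row_j 'D_(delta_mx 0 j) f x.

(* Continuity of the gradient on A follows from the Lipschitz bound. *)
Definition smooth_on A (L : R) f : Prop :=
  (forall x, A x -> differentiable f x) /\
  forall x y, A x -> A y -> enorm (grad f x - grad f y) <= L * enorm (x - y).

Definition C1_on A f : Prop :=
  (forall x, A x -> differentiable f x) /\ {within A, continuous (grad f)}.

End Euclidean.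

Section Probability.
Context {d : measure_display} {T : measurableType d} {R : realType}.
Variable Pr : probability T R.

Definition mutually_independent {I : finType} (F : I -> set (set T)) : Prop :=
  forall (J : {set I}) (A : I -> set T), (forall i, i \in J -> F i (A i)) ->
    Pr (\bigcap_(i in [set` J]) A i) = (\prod_(i in J) Pr (A i))%E.

(* Z is a version of the conditional expectation of Y given the
   sub-sigma-algebra G. *)
Definition is_cond_exp (G : set (set T)) (Y Z : T -> R) : Prop :=
  [/\ Pr.-integrable setT (EFin \o Y),
      Pr.-integrable setT (EFin \o Z),
      forall B, measurable B -> G (Z @^-1` B) &
      forall A, G A ->
        (\int[Pr]_(w in A) (Y w)%:E = \int[Pr]_(w in A) (Z w)%:E)%E].

Definition is_vec_cond_exp (m : nat) (G : set (set T))
    (Y Z : T -> 'rV[R]_m) : Prop :=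
  forall j, is_cond_exp G (fun w => Y w 0 j) (fun w => Z w 0 j).

End Probability.

Section Game.
Context {R : realType} {N : nat} {n : 'I_N -> nat} {p : nat}.

Local Notation profile := 'rV[R]_(\sum_(i < N) n i).

Variable X : forall i, set 'rV[R]_(n i).

Definition profiles : set profile := [set x | forall i, X (submxrow x i)].

(* (y, x_{-i}) *)
Definition deviate (i : 'I_N) (x : profile) (y : 'rV[R]_(n i)) : profile :=
  \mxrow_j dfwith (submxrow x) i y j.

Definition pgrad (i : 'I_N) (f : profile -> R) (x : profile) : 'rV[R]_(n i) :=
  grad (fun y => f (deviate x y)) (submxrow x i).

Definition is_potential (f : 'I_N -> profile -> R) (P : profile -> R) : Prop :=
  forall i (x : profile) (y1 y2 : 'rV[R]_(n i)),
    (forall j, j != i -> X (submxrow x j)) -> X y1 -> X y2 ->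
    P (deviate x y1) - P (deviate x y2) =
    f i (deviate x y1) - f i (deviate x y2).

Definition pseudograd (f : 'I_N -> profile -> R) (x : profile) : profile :=
  \mxrow_i pgrad i (f i) x.

Definition residual (gam : R) (x v : profile) : profile :=
  gam^-1 *: (x - eproj profiles (x - gam *: v)).

Variable ft : 'I_N -> profile -> 'rV[R]_p -> R.

Definition objective (nu : probability (borel_rV R p) R) (i : 'I_N)
    (x : profile) : R :=
  Rintegral nu setT (fun z => ft i x z).

(* Besides what defines the game, this records what is needed for f_i and its
   partial gradients to be meaningful: f~_i is jointly measurable and
   nu-integrable in the sample, and f_i is differentiable in x_i. *)
Definition stochastic_game (nu : probability (borel_rV R p) R) : Prop :=
  [/\ forall i, closed (@X i) /\
        convex_set (@X i : set (convex_lmodType 'rV[R]_(n i))),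
      forall i, measurable_fun setT
        (fun u : borel_rV R (\sum_(i < N) n i) * borel_rV R p => ft i u.1 u.2),
      forall i x z, profiles x ->
        C1_on (@X i) (fun y => ft i (deviate x y) z),
      forall i x, profiles x ->
        nu.-integrable setT (fun z => (ft i x z)%:E) &
      forall i x, profiles x ->
        differentiable (fun y => objective nu i (deviate x y)) (submxrow x i)].

Section Scheme.
Context {d : measure_display} {Omega : measurableType d}.
Variable Pr : probability Omega R.
Variables (x0 : profile) (gam : nat -> R) (S : nat -> nat).
(* xi k i l is the (l+1)-st sample drawn by player i at iteration k; only the
   indices l < S k are used. *)
Variable xi : nat -> 'I_N -> nat -> {RV Pr >-> borel_rV R p}.

Definition sample_grad (k : nat) (i : 'I_N) (l : nat) (x : profile)
    (w : Omega) : 'rV[R]_(n i) :=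
  pgrad i (fun y => ft i y (xi k i l w)) x.

Definition batch_grad (k : nat) (x : profile) (w : Omega) : profile :=
  \mxrow_i ((S k)%:R^-1 *: \sum_(l < S k) sample_grad k i l x w).

(* The iterates are defined for every k; the output of the scheme is the
   iterate at the random index drawn from P_R. *)
Fixpoint iterate (k : nat) (w : Omega) : profile :=
  if k is k'.+1 then
    let x := iterate k' w in
    \mxrow_i eproj (@X i)
      (submxrow x i - gam k' *: submxrow (batch_grad k' x w) i)
  else x0.

Definition past (k : nat) : set (set Omega) :=
  <<s [set A | exists j i l, [/\ (j < k)%N, (l < S j)%N &
                               g_sigma_algebra_preimage (xi j i l) A]] >>.

Definition sigma_iterate (k : nat) : set (set Omega) :=
  g_sigma_algebra_preimage
    (iterate k : Omega -> borel_rV R (\sum_(i < N) n i)).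

(* At iteration k each player draws a batch of i.i.d. realizations of xi,
   independent of all earlier draws. *)
Definition fresh_batch (nu : probability (borel_rV R p) R) (k : nat) : Prop :=
  forall i : 'I_N,
    (forall l, (l < S k)%N -> forall B, measurable B ->
       distribution Pr (xi k i l) B = nu B) /\
    mutually_independent Pr
      (fun o : option 'I_(S k) =>
         if o is Some l then g_sigma_algebra_preimage (xi k i l) else past k).

Definition sample_error (f : 'I_N -> profile -> R) (k : nat) (i : 'I_N)
    (l : nat) (w : Omega) : 'rV[R]_(n i) :=
  sample_grad k i l (iterate k w) w - pgrad i (f i) (iterate k w).

Definition bias_bound (f : 'I_N -> profile -> R) (k : nat) (mu : R) : Prop :=
  forall i l, (l < S k)%N ->
    exists Z : Omega -> 'rV[R]_(n i),
      is_vec_cond_exp Pr (sigma_iterate k) (sample_error f k i l) Z /\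
      {ae Pr, forall w, enorm (Z w) <= mu}.

Definition second_moment_bound (f : 'I_N -> profile -> R) (k : nat)
    (sigma : R) : Prop :=
  forall i l, (l < S k)%N ->
    exists Z : Omega -> R,
      is_cond_exp Pr (sigma_iterate k)
        (fun w => enorm (sample_error f k i l w) ^+ 2) Z /\
      {ae Pr, forall w, Z w <= sigma ^+ 2}.

(* The hypotheses on one run of the scheme with iteration limit K and random
   output index Rk. The iterates that can be reached, and the batch entering
   the residual at the output, have indices k <= K. *)
Definition rsg_run (nu : probability (borel_rV R p) R) (L : R) (K : nat)
    (mu sigma : nat -> R) (Rk : {RV Pr >-> nat}) : Prop :=
  [/\ profiles x0,
      (0 < K)%N,
      forall k, 0 < gam k /\ gam k <= 1 / (2 * L),
      forall k, (0 < S k)%N &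
   [/\ forall k, (k <= K)%N -> fresh_batch nu k,
       mutually_independent Pr
         (fun b : bool =>
            if b then g_sigma_algebra_preimage Rk else past K.+1),
       forall k, (1 <= k <= K)%N ->
         Pr (Rk @^-1` [set k]) =
         ((gam k - L * gam k ^+ 2) /
          \sum_(1 <= j < K.+1) (gam j - L * gam j ^+ 2))%:E,
       forall k, (k <= K)%N -> 0 < mu k /\ bias_bound (objective nu) k (mu k) &
       forall k, (k <= K)%N ->
         0 < sigma k /\ second_moment_bound (objective nu) k (sigma k)]].

(* E[ || G_{gamma_R}(x^R) ||^2 ] *)
Definition mean_sq_residual (f : 'I_N -> profile -> R) (Rk : Omega -> nat) :
    \bar R :=
  'E_Pr[fun w =>
    let k := Rk w in let x := iterate k w in
    enorm (residual (gam k) x (pseudograd f x)) ^+ 2].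

(* E[ || G~_{gamma_R}(x^R, xi^R) ||^2 ] *)
Definition mean_sq_sample_residual (Rk : Omega -> nat) : \bar R :=
  'E_Pr[fun w =>
    let k := Rk w in let x := iterate k w in
    enorm (residual (gam k) x (batch_grad k x w)) ^+ 2].

End Scheme.
End Game.

(* Main.v *)
(* The descent lemma for the potential P along the projected step, with the sampled gradient
   F~ = F + e, gives pointwise
     (g - L g^2) |G~|^2 <= P(x^k) - P(x^{k+1}) + g <e, G~>,   g = gamma_k,
   since F and grad P agree on differences of points of X. As the projection is firmly
   nonexpansive, <e, G~> <= |e|^2 + <e, G>, and Young's inequality with weight c^2 splits
   <e, G>; telescoping and averaging over R gives (i) once
     E|e|^2 <= N (sigma^2 + (S - 1) mu^2) / S.
   In that bound the cross terms of a batch are E<e_l, e_l'> = E|b(x^k)|^2, where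
   b(x) = int (grad f~(x, z) - grad f(x)) nu(dz): freeze x^k and the first sample, then x^k, by
   Fubini. The conditional expectation of a single error is a version of b(x^k), which is
   thus bounded by mu almost surely.
   For (ii), |G|^2 <= 2 |G~|^2 + 2 |e|^2 is combined with (i); the term in E|G|^2 can be
   absorbed because the descent inequality with e = 0 bounds |G| pointwise. *)

(* P is a potential on X only, and X may have empty interior, so grad P and F can differ in
   infeasible directions. Only their products with differences of points of X are compared, through
   one-sided difference quotients. The bias is conditioned on x^k, independence is relative to the
   whole past. Freezing needs the error as a jointly measurable function of (x^k, sample), whereas
   the gradients come from derivatives that are under control at points of X only. Hence total
   measurable surrogates, limits superior of difference quotients, which equal the partial
   derivatives along the iterates. The index R is independent of all batches up to T, which turns an
   expectation at R into a sum over 1..T with weights proportional to g - L g^2. The descent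
   coefficient g - (L/2) g^2 is weakened to this weight. From g <= 1/(2L) one gets g/2 <= g - L g^2,
   so the coefficient g/(2 c^2) of |G|^2 is at most the weight divided by c^2: this is the 1/c^2 of
   (i). *)
Require Import Defs.
From HB Require Import structures.
From mathcomp Require Import all_boot all_order all_algebra.
From mathcomp Require Import all_classical all_reals all_analysis.
From mathcomp Require Import measurable_realfun ring lra.

Set Implicit Arguments.
Unset Strict Implicit.
Unset Printing Implicit Defensive.

Import Order.TTheory GRing.Theory Num.Theory numFieldNormedType.Exports.

Local Open Scope classical_set_scope.
Local Open Scope ring_scope.

(** * Projections onto closed convex sets *)

Section EuclideanGeometry.
Context {R : realType} {m : nat}.
Implicit Types (x y z w : 'rV[R]_m) (A : set 'rV[R]_m).

Definition dotv x y : R := \sum_j x 0 j * y 0 j.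

Lemma dotvC x y : dotv x y = dotv y x.
Proof. by apply: eq_bigr => j _; rewrite mulrC. Qed.

Lemma dotvDl x y z : dotv (x + y) z = dotv x z + dotv y z.
Proof.
by rewrite /dotv -big_split; apply: eq_bigr => j _; rewrite mxE mulrDl.
Qed.

Lemma dotvNl x y : dotv (- x) y = - dotv x y.
Proof. by rewrite /dotv -sumrN; apply: eq_bigr => j _; rewrite mxE mulNr. Qed.

Lemma dotvZl a x y : dotv (a *: x) y = a * dotv x y.
Proof.
by rewrite /dotv mulr_sumr; apply: eq_bigr => j _; rewrite mxE mulrA.
Qed.

Lemma dotvDr x y z : dotv x (y + z) = dotv x y + dotv x z.
Proof. by rewrite dotvC dotvDl dotvC (dotvC z). Qed.

Lemma dotvNr x y : dotv x (- y) = - dotv x y.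
Proof. by rewrite dotvC dotvNl dotvC. Qed.

Lemma dotvZr a x y : dotv x (a *: y) = a * dotv x y.
Proof. by rewrite dotvC dotvZl dotvC. Qed.

(** Squared norms are carried as [dotv x x]: after expansion by these rules, inequalities are linear
    in the scalar products and in reach of [lra]. *)
Definition dotvE := (dotvDl, dotvDr, dotvNl, dotvNr, dotvZl, dotvZr).

Lemma dotv_subZ a x y :
  dotv (x - a *: y) (x - a *: y) = dotv x x - 2 * a * dotv x y + a ^+ 2 * dotv y y.
Proof. by rewrite !dotvE (dotvC y x); ring. Qed.

Lemma dotv_ge0 x : 0 <= dotv x x.
Proof. by apply: sumr_ge0 => j _; rewrite -expr2 sqr_ge0. Qed.

Lemma dotv_eq0 x : dotv x x = 0 -> x = 0.
Proof.
move=> /eqP; rewrite psumr_eq0 => [/allP x0|j _]; last by rewrite -expr2 sqr_ge0.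
apply/rowP => j; rewrite mxE; have := x0 j; rewrite mem_index_enum => /(_ isT).
by rewrite -expr2 sqrf_eq0 => /eqP.
Qed.

Lemma sqr_enorm x : enorm x ^+ 2 = dotv x x.
Proof.
rewrite /enorm sqr_sqrtr; last by apply: sumr_ge0 => j _; exact: sqr_ge0.
by apply: eq_bigr => j _; rewrite expr2.
Qed.

Lemma enorm_ge0 x : 0 <= enorm x.
Proof. exact: sqrtr_ge0. Qed.

Lemma ler_enorm x y : (enorm x <= enorm y) = (dotv x x <= dotv y y).
Proof. by rewrite -!sqr_enorm ler_sqr ?nnegrE ?enorm_ge0. Qed.

Lemma enorm0 : enorm (0 : 'rV[R]_m) = 0.
Proof.
by rewrite /enorm big1 ?sqrtr0// => j _; rewrite mxE expr2 mulr0.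
Qed.

Lemma le_coord_enorm x j : `|x 0 j| <= enorm x.
Proof.
rewrite -(@ler_sqr _ `|x 0 j|) ?nnegrE ?enorm_ge0// real_normK ?num_real//.
rewrite sqr_enorm /dotv (bigD1 j)//= -expr2 lerDl.
by apply: sumr_ge0 => i _; rewrite -expr2 sqr_ge0.
Qed.

Lemma enorm_continuous : continuous (@enorm R m).
Proof.
move=> x; apply: (@continuous_comp _ _ _ _ (@Num.sqrt R)); last exact: sqrt_continuous.
apply: continuous_big => [|j _ {}x]; first exact: add_continuous.
apply: (@continuous_comp _ _ _ _ (fun t : R => t ^+ 2)).
  exact: coord_continuous.
exact: exprn_continuous.
Qed.

(** The obtuse-angle characterization of the projection. Everything about [eproj] passes through it,
    so that the choice operator is faced only in [eproj_eq]. *)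
Definition variational A y z := A z /\ forall w, A w -> dotv (y - z) (w - z) <= 0.

(** Expanding |y - w|^2 around z turns the variational inequality into a Pythagorean one, which
    makes z a minimizer of the distance and forces any other minimizer to equal z. *)
Lemma eproj_eq A y z : variational A y z -> eproj A y = z.
Proof.
move=> [Az Vz].
have pyth w : A w -> dotv (y - z) (y - z) + dotv (z - w) (z - w) <= dotv (y - w) (y - w).
  by move=> /Vz; rewrite !dotvE !(dotvC w) (dotvC z y); lra.
have : [set z | A z /\ forall w, A w -> enorm (y - z) <= enorm (y - w)] (eproj A y).
  apply: (@getI _ _ z); split=> // w /pyth; rewrite ler_enorm.
  by have := dotv_ge0 (z - w); lra.
set p := eproj A y; move=> [Ap /(_ z Az)]; rewrite ler_enorm => le_p.
have : dotv (z - p) (z - p) = 0.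
  by apply/eqP; rewrite eq_le dotv_ge0 andbT; have := pyth p Ap; lra.
by move=> /dotv_eq0/eqP; rewrite subr_eq0 => /eqP.
Qed.

Lemma convex_segment A x y (t : R) :
  convex_set (A : set (convex_lmodType 'rV[R]_m)) -> A x -> A y ->
  0 <= t <= 1 -> A (x + t *: (y - x)).
Proof.
move=> cA Ax Ay /andP[t0 t1].
have := cA y x (@Itv01 R t t0 t1) (mem_set Ay) (mem_set Ax).
rewrite inE /conv/= /unstable.onem scalerBl scale1r scalerBr => h.
by rewrite addrCA addrC -addrA [- _ + x]addrC addrC in h *.
Qed.

(** A minimizer exists by compactness once A is cut by the ball around y through a; it is
    variational because no short move inside A may bring it closer to y. *)
Lemma variational_eproj A y :
  closed A -> convex_set (A : set (convex_lmodType 'rV[R]_m)) -> A !=set0 ->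
  variational A y (eproj A y).
Proof.
move=> clA cA [a Aa].
pose B := A `&` [set w | enorm (y - w) <= enorm (y - a)].
have cont_d : continuous (fun w : 'rV[R]_m => enorm (y - w)).
  move=> w; apply: continuous_comp; last exact: enorm_continuous.
  by apply: (@continuousB _ _ _ (cst y) id); [exact: cst_continuous|exact: cvg_id].
have compB : compact B.
  apply: bounded_closed_compact; last first.
    apply: closedI => //.
    by apply: (preimage_closed (f := fun w => enorm (y - w))
      (D := [set t | t <= enorm (y - a)])) => [w _|]; [exact: cont_d|exact: closed_le].
  exists (enorm (y - a) + `|y|); split; first exact: num_real.
  move=> M ltM w [_ /= wB].
  rewrite (le_trans _ (ltW ltM))// -[w](subrK y) (le_trans (ler_normD _ _))// lerD2r.
  (* Boundedness refers to the max norm, each entry of which is controlled by the Euclidean norm. *)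
  rewrite distrC [leLHS]/Num.norm/= mx_normrE.
  apply: bigmax_le => [|[i j] _]; first exact: enorm_ge0.
  by rewrite ord1 (le_trans _ wB)//; exact: le_coord_enorm.
have [||z /set_mem[Az zB] minz] := EVT_min_rV _ compB (f := fun w => enorm (y - w)).
- by exists a; split=> //=.
- by apply: continuous_subspaceT.
have min_z w : A w -> dotv (y - z) (y - z) <= dotv (y - w) (y - w).
  move=> Aw; rewrite -ler_enorm.
  have [wB|/ltW wB] := leP (enorm (y - w)) (enorm (y - a)); first by apply: minz; rewrite inE.
  exact: le_trans zB wB.
suff V : variational A y z by rewrite (eproj_eq V).
split=> // w Aw; rewrite leNgt; apply/negP => gt0.
set q := dotv (w - z) (w - z); set g := dotv (y - z) (w - z) in gt0.
have q0 : 0 <= q by exact: dotv_ge0.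
have qg : 0 < q + g by lra.
(* Moving from z towards w by t changes the squared distance by t * (t * q - 2 * g). Dividing by q +
   g instead of q avoids the case q = 0, keeps t in ]0, 1] and gives t * q <= g, so the change is
   negative. *)
pose t := g / (q + g).
have t0 : 0 < t by rewrite divr_gt0.
have t1 : t <= 1 by rewrite ler_pdivrMr// mul1r; lra.
have /min_z : A (z + t *: (w - z)) by apply: convex_segment => //; rewrite ltW.
have -> : y - (z + t *: (w - z)) = (y - z) - t *: (w - z) by rewrite opprD addrA.
rewrite dotv_subZ -/g -/q => h.
have : 0 <= t * (t * q - 2 * g) by lra.
rewrite pmulr_rge0// => h'.
have : t * q <= g by rewrite /t mulrAC ler_pdivrMr// ler_pM2l//; lra.
by lra.
Qed.

(** Add the two variational inequalities, each tested at the other projection. *)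
Lemma variational_firm A y y' z z' : variational A y z -> variational A y' z' ->
  dotv (z - z') (z - z') <= dotv (y - y') (z - z').
Proof.
move=> [Az Vz] [Az' Vz']; have := Vz _ Az'; have := Vz' _ Az.
rewrite -(opprB z z') dotvNr !(dotvDl, dotvNl); lra.
Qed.

Lemma young_dotv x y (a : R) : 0 < a ->
  dotv x y <= a / 2 * dotv x x + 1 / (2 * a) * dotv y y.
Proof.
move=> a0; have := dotv_ge0 (a *: x - y); rewrite !dotvE (dotvC y x) => h.
rewrite -(@ler_pM2l _ (2 * a)) ?mulr_gt0//.
have -> : 2 * a * (a / 2 * dotv x x + 1 / (2 * a) * dotv y y) =
  a * (a * dotv x x) + dotv y y by field; rewrite gt_eqF.
by lra.
Qed.

Lemma variational_nonexpansive A y y' z z' : variational A y z -> variational A y' z' ->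
  dotv (z - z') (z - z') <= dotv (y - y') (y - y').
Proof.
move=> Vz Vz'; have := variational_firm Vz Vz'.
by have := young_dotv (y - y') (z - z') ltr01; lra.
Qed.

End EuclideanGeometry.

(** * Borel measurability of row vectors *)

Section BorelRowVectors.
Context {R : realType} {m : nat}.
Context {d : measure_display} {T : measurableType d}.

Lemma measurable_continuous_rV (g : 'rV[R]_m -> R) :
  continuous g -> measurable_fun [set: borel_rV R m] g.
Proof.
move=> /continuousP cg; apply: (measurability _ (RGenOpens.measurableE R)).
move=> _ [_ [a [b ->] <-]]; rewrite setTI; apply: sub_sigma_algebra.
exact/cg/interval_open.
Qed.

Lemma measurable_coord_rV j :
  measurable_fun [set: borel_rV R m] (fun x : borel_rV R m => x 0 j).
Proof. by apply: measurable_continuous_rV; exact: coord_continuous. Qed.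

(** Rational centres and radii 1 / (k + 1) give a countable base of the topology, which reduces
    Borel measurability of a vector to that of its coordinates. *)
Let box (a : 'rV[rat]_m * nat) : set 'rV[R]_m :=
  [set x | forall j, `|x 0 j - ratr (a.1 0 j)| < a.2.+1%:R^-1].

Lemma open_bigcup_box (U : set 'rV[R]_m) : open U ->
  U = \bigcup_(a in [set a | box a `<=` U]) box a.
Proof.
move=> oU; rewrite eqEsubset; split=> [x Ux|x [a /= aU]]; last exact: aU.
have /nbhs_ballP[e /= e0 eU] : nbhs x U by exact: open_nbhs_nbhs.
have [k ke] : exists k : nat, k.+1%:R^-1 < e / 2.
  have [k _ kP] := near_infty_natSinv_lt (PosNum (divr_gt0 e0 (ltr0n _ 2))).
  by exists k; apply: (kP k) => /=.
have : 0 < k.+1%:R^-1 :> R by rewrite invr_gt0 ltr0n.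
have bk : forall q, box (q, k) =
  [set x | forall j, `|x 0 j - ratr (q 0 j)| < k.+1%:R^-1] by [].
move: ke bk; set r := k.+1%:R^-1 => kr bk k0.
have /choice[q qx] : forall j, exists q : rat, `|x 0 j - ratr q| < r.
  move=> j; have [|q] := @rat_in_itvoo R (x 0 j - r) (x 0 j + r).
    by lra.
  by rewrite in_itv/= => /andP[q1 q2]; exists q; rewrite ltr_norml; lra.
exists (\row_j q j, k); rewrite /= bk; last by move=> j; rewrite mxE; exact: qx.
move=> y /= yq; apply: eU; split=> //= i j; rewrite ord1.
have := yq j; rewrite mxE => yj; have xj := qx j.
rewrite /ball/= (_ : x 0 j - y 0 j = (x 0 j - ratr (q j)) - (y 0 j - ratr (q j))); last by lra.
by rewrite (le_lt_trans (ler_normB _ _))//; lra.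
Qed.

Lemma measurable_rVP (f : T -> 'rV[R]_m) :
  (forall j, measurable_fun setT (fun w => f w 0 j)) ->
  measurable_fun setT (f : T -> borel_rV R m).
Proof.
move=> mf; apply: (measurability (open : set (set (borel_rV R m)))) => //.
move=> _ [U oU <-]; rewrite setTI (open_bigcup_box oU) preimage_bigcup.
rewrite bigcup_mkcond; apply: countable_bigcupT_measurable => [|a]; first exact: countableP.
case: ifPn => // _.
have -> : f @^-1` box a = \bigcap_(j in [set: 'I_m])
    (fun w => f w 0 j) @^-1` [set t | `|t - ratr (a.1 0 j)| < a.2.+1%:R^-1].
  by rewrite eqEsubset; split=> [w /= h j _|w /= h j]; exact: h.
apply: fin_bigcap_measurable => // j _.
rewrite -[X in measurable X]setTI; apply: mf => //.
rewrite (_ : [set t | _] = `](ratr (a.1 0 j) - a.2.+1%:R^-1),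
  (ratr (a.1 0 j) + a.2.+1%:R^-1)[%classic).
  exact: measurable_itv.
apply/seteqP; split=> t /=; rewrite in_itv/= ltr_norml; move: _^-1 => r; lra.
Qed.

End BorelRowVectors.

(** * Directional derivatives *)

Section DirectionalDerivatives.
Context {R : realType} {m : nat}.
Implicit Types (f : 'rV[R]_m -> R) (x y v : 'rV[R]_m) (A : set 'rV[R]_m).

Lemma derive_dotv f x v : differentiable f x -> 'D_v f x = dotv (grad f x) v.
Proof.
move=> df; rewrite deriveE// [in LHS](row_sum_delta v) linear_sum.
by apply: eq_bigr => j _; rewrite linearZ mxE deriveE// mulrC.
Qed.

Lemma is_derive_line f x v (t : R) : differentiable f (x + t *: v) ->
  is_derive t 1 (fun s : R => f (x + s *: v)) (dotv (grad f (x + t *: v)) v).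
Proof.
move=> df; have dv : derivable f (x + t *: v) v by exact: diff_derivable.
have E : (fun h : R => h^-1 *: (((fun s : R => f (x + s *: v)) \o shift t) (h *: (1 : R)) -
     f (x + t *: v))) =
   (fun h : R => h^-1 *: ((f \o shift (x + t *: v)) (h *: v) - f (x + t *: v))).
  apply/funext => h /=; congr (_ *: (f _ - _)).
  by rewrite scaler1 scalerDl addrCA.
by split; [rewrite /derivable E|rewrite /derive E -derive_dotv].
Qed.

(** The mean value theorem on [0, 1] is applied to f along the segment minus the first-order term
    and the quadratic L / 2 * q * t^2. The derivative of this difference is nonpositive by the
    Lipschitz bound, used only inside A. *)
Lemma smooth_on_descent A (L : R) f x y : 0 < L -> smooth_on A L f ->
  convex_set (A : set (convex_lmodType 'rV[R]_m)) -> A x -> A y ->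
  f y <= f x + dotv (grad f x) (y - x) + L / 2 * dotv (y - x) (y - x).
Proof.
move=> L0 [df lip] cA Ax Ay; set v := y - x; set q := dotv v v.
pose phi t := f (x + t *: v) - (t * dotv (grad f x) v + L / 2 * q * t ^+ 2).
pose dphi t := dotv (grad f (x + t *: v)) v - (dotv (grad f x) v + L * q * t).
have Aseg (t : R) : 0 <= t <= 1 -> A (x + t *: v) by exact: convex_segment.
have dphiE (t : R) : 0 <= t <= 1 -> is_derive t 1 phi (dphi t).
  move=> t01; have := is_derive_line (df _ (Aseg _ t01)) => d1.
  rewrite /phi; apply: is_deriveB.
  apply: is_derive_eq; rewrite /GRing.scale/=.
  by rewrite !(mulr1, scale1r, mulr0, addr0, add0r)/=; field.
have [|||c c01] := @MVT_segment _ phi dphi 0 1; rewrite ?ler01//.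
- by move=> t /[!in_itv]/= /andP[t0 t1]; apply: dphiE; rewrite !ltW.
- apply: derivable_within_continuous => t /[!in_itv]/= t01.
  by have [] := dphiE _ t01.
rewrite subr0 mulr1 => phiE.
suff : dphi c <= 0.
  have phi1 : phi 1 = f y - (dotv (grad f x) v + L / 2 * q).
    by rewrite /phi scale1r /v (addrC x) subrK mul1r expr1n mulr1.
  have phi0 : phi 0 = f x.
    by rewrite /phi scale0r mul0r expr0n/= mulr0 !addr0 subr0.
  by rewrite -phiE phi1 phi0; lra.
move: c01; rewrite in_itv/= => /andP[]; rewrite le_eqVlt => /predU1P[<- _|c0 c1].
  by rewrite /dphi scale0r addr0; lra.
have Lc0 : 0 < L * c by rewrite mulr_gt0.
have := lip _ _ (Aseg c _) Ax; rewrite ltW// c1 => /(_ isT).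
set g := grad f _ - _; rewrite addrC addKr => lip'.
have gle : dotv g g <= (L * c) ^+ 2 * q.
  have : enorm g ^+ 2 <= (L * enorm (c *: v)) ^+ 2.
    by rewrite ler_sqr ?nnegrE ?mulr_ge0 ?enorm_ge0// ltW.
  by rewrite exprMn !sqr_enorm /q (dotvZl c v (c *: v)) dotvZr; lra.
(* Since |g| <= L c |v|, the weight 1 / (L c) balances the two halves: each is at most L c / 2 * q.
   This weight is why c = 0 was set apart. *)
have := @young_dotv _ _ g v (L * c)^-1; rewrite invr_gt0 => /(_ Lc0).
have : (L * c)^-1 / 2 * dotv g g <= L * c / 2 * q.
  have -> : L * c / 2 * q = (L * c)^-1 / 2 * ((L * c) ^+ 2 * q).
    by field; rewrite gt_eqF//= gt_eqF.
  by rewrite ler_pM2l// divr_gt0// invr_gt0.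
have -> : 1 / (2 * (L * c)^-1) * dotv v v = L * c / 2 * q.
  by rewrite invfM invrK mul1r (mulrC 2^-1).
have : dphi c = dotv g v - L * c * q by rewrite /dphi /g dotvDl dotvNl; ring.
by move=> ->; move: (dotv g v) (dotv g g) => *; lra.
Qed.

(** A two-sided derivative is already determined from the right. This is needed because, at a point
    of X, the step towards another point of X may be feasible on one side only. *)
Lemma derive_eq_right (V W : normedModType R) (F : V -> R) (G : W -> R)
    (a v : V) (b w : W) :
  derivable F a v -> derivable G b w ->
  (forall h : R, 0 < h <= 1 -> F (a + h *: v) - F a = G (b + h *: w) - G b) ->
  'D_v F a = 'D_w G b.
Proof.
move=> dF dG FG.
have cF : h^-1 *: ((F \o shift a) (h *: v) - F a) @[h --> 0^'+] --> 'D_v F a.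
  exact: cvg_dnbhs_at_right dF.
have cG : h^-1 *: ((G \o shift b) (h *: w) - G b) @[h --> 0^'+] --> 'D_w G b.
  exact: cvg_dnbhs_at_right dG.
suff cF' : h^-1 *: ((G \o shift b) (h *: w) - G b) @[h --> 0^'+] --> 'D_v F a.
  exact: (cvg_unique (@Rhausdorff R) cF' cG).
apply: cvg_trans cF; apply: near_eq_cvg; near=> h.
rewrite /= (addrC (h *: v)) (addrC (h *: w)) FG//.
by apply/andP; split; near: h; [exact: nbhs_right_gt|exact: nbhs_right_le].
Unshelve. all: by end_near. Qed.

(** A sequence, rather than a limit over real steps, lets measurability pass to the derivative. *)
Lemma derive_cvg_seq f x v : differentiable f x ->
  (fun k : nat => k.+1%:R * (f (x + k.+1%:R^-1 *: v) - f x)) @ \oo --> 'D_v f x.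
Proof.
move=> df; have dv : derivable f x v by exact: diff_derivable.
have [/(_ dv (fun k => k.+1%:R^-1)) + _] := cvgr_dnbhsP
  (fun h => h^-1 *: ((f \o shift x) (h *: v) - f x)) 0 ('D_v f x).
have -> : (fun k : nat => k.+1%:R * (f (x + k.+1%:R^-1 *: v) - f x)) =
  (fun h => h^-1 *: ((f \o shift x) (h *: v) - f x)) \o (fun k : nat => k.+1%:R^-1 : R).
  by apply/funext => k /=; rewrite invrK (addrC x).
by apply; split=> [k|]; [rewrite invr_neq0// pnatr_eq0|exact: cvg_harmonic].
Qed.
End DirectionalDerivatives.

(** * Descent along a projected step *)

Section Profiles.
Context {R : realType} {N : nat} {n : 'I_N -> nat}.
Local Notation profile := 'rV[R]_(\sum_(i < N) n i).
Variable X : forall i, set 'rV[R]_(n i).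
Implicit Types x y : profile.
Hypothesis X_closed : forall i, closed (@X i).
Hypothesis X_convex : forall i, convex_set (@X i : set (convex_lmodType 'rV[R]_(n i))).

Lemma dotv_submxrow x y : dotv x y = \sum_i dotv (submxrow x i) (submxrow y i).
Proof.
have dotvE m (u v : 'rV[R]_m) : dotv u v = (u *m v^T) 0 0.
  by rewrite mxE; apply: eq_bigr => j _; rewrite mxE.
rewrite dotvE -{1}(submxrowK x) -{1}(submxrowK y) tr_mxrow mul_mxrow_mxcol summxE.
by apply: eq_bigr => i _; rewrite dotvE.
Qed.

Lemma submxrowZ (a : R) x i : submxrow (a *: x) i = a *: submxrow x i.
Proof. by apply/matrixP => j k; rewrite !mxE. Qed.

Lemma submxrow_inj x y : (forall i, submxrow x i = submxrow y i) -> x = y.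
Proof.
by move=> xy; rewrite -(submxrowK x) -(submxrowK y); apply: eq_mxrow.
Qed.

Lemma submxrow_deviate i x (y : 'rV[R]_(n i)) : submxrow (deviate x y) i = y.
Proof. by rewrite mxrowK dfwithin. Qed.

Lemma submxrow_deviateN i j x (y : 'rV[R]_(n i)) : j != i ->
  submxrow (deviate x y) j = submxrow x j.
Proof. by move=> ji; rewrite mxrowK dfwithout// eq_sym. Qed.

Lemma deviate_line i x (v : 'rV[R]_(n i)) (h : R) :
  deviate x (submxrow x i + h *: v) = x + h *: deviate 0 v.
Proof.
apply: submxrow_inj => j; rewrite submxrowD submxrowZ.
have [->|ji] := eqVneq j i; first by rewrite !submxrow_deviate.
by rewrite !submxrow_deviateN// submxrow0 scaler0 addr0.
Qed.

Lemma deviate_submxrow i x : deviate x (submxrow x i) = x.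
Proof. by have := deviate_line x (0 : 'rV_(n i)) 0; rewrite !scale0r !addr0. Qed.

Lemma sum_deviate0 x : x = \sum_i deviate 0 (submxrow x i).
Proof.
apply: submxrow_inj => j.
have submxrow_sum (F : 'I_N -> profile) : submxrow (\sum_i F i) j = \sum_i submxrow (F i) j.
  by apply: (big_morph _ (fun u v => submxrowD u v j)); exact: submxrow0.
rewrite submxrow_sum (bigD1 j)//= submxrow_deviate big1 ?addr0// => i ij.
by rewrite submxrow_deviateN 1?eq_sym// submxrow0.
Qed.

Lemma profiles_convex : convex_set (profiles X : set (convex_lmodType profile)).
Proof.
move=> x y t /set_mem px /set_mem py; apply/mem_set => i.
have := @X_convex i (submxrow x i) (submxrow y i) t (mem_set (px i)) (mem_set (py i)).
by rewrite inE /conv/= submxrowD !submxrowZ.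
Qed.

(** The variational inequalities of the blocks add up. This identifies the playerwise updates of
    [iterate] with one projection onto [profiles X]. *)
Lemma variational_eproj_profiles x0 y : profiles X x0 ->
  variational (profiles X) y (\mxrow_i eproj (@X i) (submxrow y i)).
Proof.
move=> px0; set z := \mxrow_i _.
have V i : variational (@X i) (submxrow y i) (submxrow z i).
  by rewrite mxrowK; apply: variational_eproj => //; exists (submxrow x0 i).
split=> [i|w pw]; first by have [] := V i.
rewrite dotv_submxrow; apply: sumr_le0 => i _; rewrite !submxrowB.
by have [_] := V i; apply.
Qed.

(** Split y - x into its blocks. By convexity, the steps h in ]0, 1] along block i stay in X_i,
    where the increments of P and f_i agree. *)
Lemma pseudograd_potential (f : 'I_N -> profile -> R) (P : profile -> R) x y :
  is_potential X f P -> differentiable P x ->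
  (forall i, differentiable (fun z => f i (deviate x z)) (submxrow x i)) ->
  profiles X x -> profiles X y ->
  dotv (pseudograd f x) (y - x) = dotv (grad P x) (y - x).
Proof.
move=> pot dP df px py.
rewrite -derive_dotv// deriveE// {2}(sum_deviate0 (y - x)) linear_sum dotv_submxrow.
apply: eq_bigr => i _; rewrite mxrowK -derive_dotv; last exact: df.
rewrite -deriveE// submxrowB.
apply: derive_eq_right; [exact: diff_derivable|exact: diff_derivable|move=> h h01].
rewrite -deviate_line -[in P x](deviate_submxrow i x).
apply/esym/pot => [j _||]; [exact: px| |exact: px].
by apply: convex_segment; [exact: X_convex|exact: px|exact: py|case/andP: h01 => /ltW -> ->].
Qed.

Lemma unbiased_step (r : profile) (L gam Q Q' Pmin : R) : 0 < L -> 0 < gam -> Pmin <= Q' ->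
  (gam - L / 2 * gam ^+ 2) * dotv r r <= Q - Q' + gam * dotv 0 r ->
  (gam - L * gam ^+ 2) * dotv r r <= Q - Pmin.
Proof.
move=> L0 g0 PQ; have -> : dotv 0 r = 0 by rewrite -(scale0r (0 : profile)) dotvZl mul0r.
have : 0 <= L / 2 * gam ^+ 2 * dotv r r.
  by rewrite !mulr_ge0 ?dotv_ge0 ?exprn_ge0 ?invr_ge0 ?ltW.
by lra.
Qed.

(** Read r as the sampled residual, s as the exact one, e as the gradient error. The 1 in 1 + c^2 /
    2 comes from <e, r - s>, the rest from Young's inequality for <e, s>. *)
Lemma biased_step (r s e : profile) (L gam c Q : R) : 0 < L -> 0 < gam -> 0 < c ->
  dotv (r - s) (r - s) <= dotv e (r - s) ->
  (gam - L / 2 * gam ^+ 2) * dotv r r <= Q + gam * dotv e r ->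
  (gam - L * gam ^+ 2) * dotv r r <=
  Q + gam * (1 + c ^+ 2 / 2) * dotv e e + gam / (2 * c ^+ 2) * dotv s s.
Proof.
move=> L0 gam0 c0 firm.
(* Young's inequality with weight 1 leaves half of |r - s|^2, which [firm] bounds by half of the
   left-hand side itself. *)
have d_rs : dotv e (r - s) <= dotv e e.
  by have := young_dotv e (r - s) ltr01; lra.
have c20 : 0 < c ^+ 2 by rewrite exprn_gt0.
have ds := young_dotv e s c20.
have -> : dotv e r = dotv e (r - s) + dotv e s by rewrite -dotvDr subrK.
move: d_rs ds; set a := dotv _ (r - s); set b := dotv _ s; set q := dotv e e.
have -> : gam / (2 * c ^+ 2) = gam * (1 / (2 * c ^+ 2)) by rewrite mul1r.
set k := 1 / _; move=> aq bq.
have : gam * (a + b) <= gam * (q + (c ^+ 2 / 2 * q + k * dotv s s)).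
  by rewrite ler_pM2l// lerD.
have : 0 <= L / 2 * gam ^+ 2 * dotv r r.
  by rewrite !mulr_ge0 ?dotv_ge0 ?exprn_ge0 ?invr_ge0 ?ltW.
move: (dotv r r) (dotv s s) a b q k {aq bq firm} => *; lra.
Qed.

Section Residuals.
Variables (f : 'I_N -> profile -> R) (P : profile -> R) (L gam : R).
Hypothesis f_P : is_potential X f P.
Hypothesis P_smooth : smooth_on (profiles X) L P.
Hypothesis f_diff : forall i x, profiles X x ->
  differentiable (fun z => f i (deviate x z)) (submxrow x i).
Hypothesis L_gt0 : 0 < L.
Hypothesis gam_gt0 : 0 < gam.
Variables (x : profile) (px : profiles X x).

Lemma variational_profiles y : variational (profiles X) y (eproj (profiles X) y).
Proof.
have V := variational_eproj_profiles y px.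
by rewrite (eproj_eq V).
Qed.

Lemma eproj_residual v :
  eproj (profiles X) (x - gam *: v) = x - gam *: residual X gam x v.
Proof.
rewrite /residual; set e := eproj _ _.
by rewrite scalerA divff ?gt_eqF// scale1r opprB addrC subrK.
Qed.

(** The variational inequality of the projected point, tested at x. *)
Lemma residual_le_dotv v : dotv (residual X gam x v) (residual X gam x v) <=
  dotv v (residual X gam x v).
Proof.
have [_ /(_ x px)] := variational_profiles (x - gam *: v).
rewrite eproj_residual; set r := residual _ _ _ _.
rewrite (_ : x - gam *: v - (x - gam *: r) = gam *: (r - v)); last first.
  by rewrite scalerBr opprB addrC addrA subrK.
rewrite subKr dotvZl dotvZr !pmulr_rle0// dotvDl dotvNl; lra.
Qed.

Lemma residual_firm u v :
  dotv (residual X gam x u - residual X gam x v) (residual X gam x u - residual X gam x v) <=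
  dotv (u - v) (residual X gam x u - residual X gam x v).
Proof.
have := variational_firm (variational_profiles (x - gam *: u))
  (variational_profiles (x - gam *: v)).
rewrite !eproj_residual.
have E a b : x - gam *: a - (x - gam *: b) = - gam *: (a - b).
  by rewrite scalerBr !scaleNr opprK opprB addrC addrA subrK addrC.
by rewrite !E !(dotvZl, dotvZr) !ler_nM2l ?oppr_lt0.
Qed.

Lemma residual_nonexpansive u v :
  dotv (residual X gam x u - residual X gam x v) (residual X gam x u - residual X gam x v) <=
  dotv (u - v) (u - v).
Proof.
have := residual_firm u v.
by have := young_dotv (u - v) (residual X gam x u - residual X gam x v) ltr01; lra.
Qed.

(** Stated for every direction v: the sampled gradient gives the descent of the scheme, and v = F
    gives the bound on the exact residual. *)
Lemma potential_descent v :
  (gam - L / 2 * gam ^+ 2) * dotv (residual X gam x v) (residual X gam x v) <=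
  P x - P (eproj (profiles X) (x - gam *: v)) +
  gam * dotv (v - pseudograd f x) (residual X gam x v).
Proof.
have := residual_le_dotv v; have [py _] := variational_profiles (x - gam *: v).
have := smooth_on_descent L_gt0 P_smooth profiles_convex px py.
have [dP _] := P_smooth.
rewrite -(pseudograd_potential f_P (dP _ px) (fun i => f_diff i px) px py).
rewrite eproj_residual; move: (residual _ _ _ _) => r.
rewrite (_ : x - gam *: r - x = - (gam *: r)); last by rewrite addrAC subrr add0r.
rewrite !dotvE; set rr := dotv r r; set vr := dotv v r.
set fr := dotv (pseudograd f x) r => le1 le2.
have : gam * rr <= gam * vr by rewrite ler_pM2l.
by lra.
Qed.

Lemma sample_residual_descent v (c : R) : 0 < c ->
  (gam - L * gam ^+ 2) * dotv (residual X gam x v) (residual X gam x v) <=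
  P x - P (eproj (profiles X) (x - gam *: v)) +
  gam * (1 + c ^+ 2 / 2) * dotv (v - pseudograd f x) (v - pseudograd f x) +
  gam / (2 * c ^+ 2) *
    dotv (residual X gam x (pseudograd f x)) (residual X gam x (pseudograd f x)).
Proof.
move=> c0; apply: biased_step => //; first exact: residual_firm.
exact: potential_descent.
Qed.

(** A deterministic bound: the exact residual along the iterates becomes integrable without any
    moment condition. *)
Lemma residual_bounded Pmin : (forall y, profiles X y -> Pmin <= P y) ->
  (gam - L * gam ^+ 2) *
    dotv (residual X gam x (pseudograd f x)) (residual X gam x (pseudograd f x)) <=
  P x - Pmin.
Proof.
move=> Pm; apply: unbiased_step (Pm _ (variational_profiles _).1) _ => //.
by have := potential_descent (pseudograd f x); rewrite subrr; exact.
Qed.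

End Residuals.

End Profiles.

(** * Freezing independent variables *)

Section Freezing.
Local Open Scope ereal_scope.
Context {d d1 d2 : measure_display} {T : measurableType d} {E : measurableType d1}
  {F : measurableType d2} {R : realType}.
Variables (Pr : probability T R) (nu : probability F R).
Variables (Y : T -> E) (xi : T -> F).
Hypotheses (mY : measurable_fun setT Y) (mxi : measurable_fun setT xi).

(** Says at once that xi has law nu (take A = [setT]) and is independent of Y. The joint law is then
    the product of the law of Y with nu, to which Fubini applies. *)
Definition indep_draw := forall (A : set E) (B : set F), measurable A -> measurable B ->
  Pr (Y @^-1` A `&` xi @^-1` B) = Pr (Y @^-1` A) * nu B.

Hypothesis Yxi : indep_draw.

Let Y' : {mfun T >-> E} := mfun_Sub (mem_set mY).
Let mYxi : measurable_fun setT (fun w => (Y w, xi w)).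
Proof. exact: measurable_fun_pair. Qed.
Let Yxi' : {mfun T >-> (E * F)%type} := mfun_Sub (mem_set mYxi).

Let joint_law (A : set (E * F)) : measurable A ->
  (distribution Pr Y' \x nu) A = distribution Pr Yxi' A.
Proof. by move=> mA; apply: product_measure_unique => // *; exact: Yxi. Qed.

Lemma ge0_integral_freeze (phi : E * F -> \bar R) :
  measurable_fun setT phi -> (forall u, 0 <= phi u) ->
  \int[Pr]_w phi (Y w, xi w) = \int[Pr]_w \int[nu]_z phi (Y w, z).
Proof.
move=> mphi phi0.
rewrite -(ge0_integral_distribution (P := Pr) Yxi' mphi phi0).
rewrite (eq_measure_integral (distribution Pr Y' \x nu)); last first.
  by move=> A mA _; first [exact: joint_law|exact: (esym (joint_law mA))].
rewrite fubini_tonelli1//.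
rewrite (ge0_integral_distribution (P := Pr) Y')//.
  exact: measurable_fun_fubini_tonelli_F.
by move=> y; exact: integral_ge0.
Qed.

Section Integrable.
Variable phi : E * F -> \bar R.
Hypothesis mphi : measurable_fun setT phi.
Hypothesis iphi : Pr.-integrable setT (fun w => phi (Y w, xi w)).

Let iphi_prod : (distribution Pr Y' \x nu).-integrable setT phi.
Proof.
apply/integrableP; split=> //.
rewrite (eq_measure_integral (distribution Pr Yxi')); last first.
  by move=> A mA _; first [exact: joint_law|exact: (esym (joint_law mA))].
rewrite (ge0_integral_distribution (P := Pr) Yxi')//.
  by have /integrableP[] := iphi.
exact: measurableT_comp.
Qed.

Lemma integrable_freeze : Pr.-integrable setT (fun w => \int[nu]_z phi (Y w, z)).
Proof.
have /integrableP[mF] := integrable_fubini_F iphi_prod.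
rewrite (ge0_integral_distribution (P := Pr) Y'); [|by apply: measurableT_comp mF|by []].
by move=> ltF; apply/integrableP; split=> //; exact: (measurableT_comp mF mY).
Qed.

Lemma integral_freeze :
  \int[Pr]_w phi (Y w, xi w) = \int[Pr]_w \int[nu]_z phi (Y w, z).
Proof.
rewrite -(integral_distribution (P := Pr) (X := Yxi') mphi)//.
rewrite (eq_measure_integral (distribution Pr Y' \x nu)); last first.
  by move=> A mA _; first [exact: joint_law|exact: (esym (joint_law mA))].
rewrite -integral12_prod_meas1//.
rewrite (integral_distribution (P := Pr) (X := Y'))//; last exact: integrable_freeze.
exact: (measurable_fubini_F iphi_prod).
Qed.

Lemma measurable_freeze : measurable_fun setT (fun y => \int[nu]_z phi (y, z)).
Proof. by have /integrableP[] := integrable_fubini_F iphi_prod. Qed.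

Lemma ae_integrable_freeze :
  {ae Pr, forall w, nu.-integrable setT (fun z => phi (Y w, z))}.
Proof.
have [A [mA A0 AN]] := ae_integrable1 iphi_prod.
exists (Y @^-1` A); split=> //; first by rewrite -[X in measurable X]setTI; exact: mY.
by move=> w; exact: AN.
Qed.

End Integrable.
End Freezing.

(** * Conditional expectations as frozen integrals *)

Section ConditionalExpectation.
Local Open Scope ereal_scope.
Context {d d1 d2 : measure_display} {T : measurableType d} {E : measurableType d1}
  {F : measurableType d2} {R : realType}.
Variables (Pr : probability T R) (nu : probability F R).

(** Uniqueness of conditional expectations. The identity from T to T' pushes Pr forward to its
    restriction to G, and on T' the sets of G are exactly the test sets of [integral_ae_eq]. *)
Lemma cond_exp_ae_eq (G : set (set T)) (U V : T -> \bar R) :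
  sigma_algebra setT G -> G `<=` measurable ->
  Pr.-integrable setT U -> Pr.-integrable setT V ->
  (forall B, measurable B -> G (U @^-1` B)) ->
  (forall B, measurable B -> G (V @^-1` B)) ->
  (forall A, G A -> \int[Pr]_(w in A) U w = \int[Pr]_(w in A) V w) ->
  {ae Pr, forall w, U w = V w}.
Proof.
move=> sG Gm iU iV GU GV UV.
pose T' := g_sigma_algebraType G.
have GE : (@measurable _ T') = G by exact: measurable_g_measurableTypeE.
have mid : measurable_fun [set: T] (id : T -> T').
  by move=> _ B; rewrite setTI GE; exact: Gm.
have mU : measurable_fun [set: T'] U by move=> _ B mB; rewrite setTI GE; exact: GU.
have mV : measurable_fun [set: T'] V by move=> _ B mB; rewrite setTI GE; exact: GV.
pose idT : {mfun T >-> T'} := mfun_Sub (mem_set mid).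
pose Pr' : probability T' R := distribution Pr idT.
have iU' : Pr'.-integrable [set: T'] U by exact: (integrable_pushforward (phi := idT)).
have [A [mA A0 AN]] : ae_eq Pr' [set: T'] U V.
  apply: integral_ae_eq => // A _ mA; have GA : G A by rewrite -GE.
  rewrite !(integral_pushforward (phi := idT))//.
  - exact: UV.
  - by apply: integrableS iV => //; exact: Gm.
  - by apply: integrableS iU => //; exact: Gm.
exists A; split=> // [|w /= Uw].
  by apply: Gm; rewrite -GE.
by apply: AN => /= /(_ I).
Qed.

Variables (Y : T -> E) (xi : T -> F).
Hypotheses (mY : measurable_fun setT Y) (mxi : measurable_fun setT xi).
Hypothesis Yxi : indep_draw Pr nu Y xi.

Lemma cond_exp_freeze (h : E * F -> R) (Z : T -> R) : measurable_fun setT h ->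
  is_cond_exp Pr (g_sigma_algebra_preimage Y) (fun w => h (Y w, xi w)) Z ->
  {ae Pr, forall w, (Z w)%:E = \int[nu]_z (h (Y w, z))%:E}.
Proof.
move=> mh [iU iZ GZ UZ].
have mhE : measurable_fun setT (EFin \o h) by exact/measurable_EFinP.
have iF := integrable_freeze mY mxi Yxi mhE iU.
have mF := measurable_freeze mY mxi Yxi mhE iU.
apply: (@cond_exp_ae_eq (g_sigma_algebra_preimage Y)) => //.
- exact: (@sigma_algebra_measurable _ (g_sigma_algebra_preimageType Y)).
- by move=> _ [B mB <-]; exact: mY.
- move=> B mB; apply: (GZ (EFin @^-1` B)).
  by rewrite -[X in measurable X]setTI; exact: EFin_measurable.
- move=> B mB; exists ((fun y => \int[nu]_z (h (y, z))%:E) @^-1` B) => //.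
    by rewrite -[X in measurable X]setTI; exact: mF.
  by rewrite setTI.
move=> _ [B mB <-]; rewrite -UZ; last by exists B.
rewrite setTI [LHS]integral_mkcond [RHS]integral_mkcond.
pose phi := (EFin \o h) \_ (fst @^-1` B).
have mfB : measurable (fst @^-1` B : set (E * F)).
  by rewrite -[X in measurable X]setTI; exact: measurable_fst.
have memE w z : ((Y w, z) \in fst @^-1` B) = (w \in Y @^-1` B).
  by apply/idP/idP; rewrite !inE.
have phiE : ((fun w => (h (Y w, xi w))%:E) \_ (Y @^-1` B)) = (fun w => phi (Y w, xi w)).
  by apply/funext => w; rewrite /phi !patchE memE.
have mYB : measurable (Y @^-1` B) by rewrite -[X in measurable X]setTI; exact: mY.
have iphi : Pr.-integrable setT (fun w => phi (Y w, xi w)).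
  by rewrite -phiE -integrable_mkcond//; exact: integrableS iU.
have mphi : measurable_fun setT phi.
  by apply/(measurable_restrictT _ mfB)/measurable_funTS.
rewrite phiE (integral_freeze mY mxi Yxi mphi iphi).
apply: eq_integral => w _; rewrite patchE; case: ifPn => wB.
  by apply: eq_integral => z _; rewrite /phi patchE memE wB.
by apply: integral0_eq => z _; rewrite /phi patchE memE (negbTE wB).
Qed.

End ConditionalExpectation.

(** * Two samples independent of each other and of a common variable *)

Section TripleDraw.
Local Open Scope ereal_scope.
Context {d d1 d2 : measure_display} {T : measurableType d} {E : measurableType d1}
  {F : measurableType d2} {R : realType}.
Variables (Pr : probability T R) (nu : probability F R).
Variables (Y : T -> E) (xi xi' : T -> F).
Hypotheses (mY : measurable_fun setT Y) (mxi : measurable_fun setT xi)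
  (mxi' : measurable_fun setT xi').
Hypothesis law3 : forall A B C, measurable A -> measurable B -> measurable C ->
  Pr (Y @^-1` A `&` xi @^-1` B `&` xi' @^-1` C) = Pr (Y @^-1` A) * nu B * nu C.

Lemma indep_draw_fst : indep_draw Pr nu Y xi.
Proof.
move=> A B mA mB; have := law3 mA mB measurableT.
by rewrite preimage_setT setIT probability_setT mule1.
Qed.

(** [law3] speaks of rectangles only, while D is arbitrary. For fixed C, both sides are measures in
    D, and uniqueness of the product measure extends their equality from rectangles. *)
Lemma indep_draw_pair : indep_draw Pr nu (fun w => (Y w, xi w)) xi'.
Proof.
move=> D C mD mC.
have mYxi : measurable_fun setT (fun w => (Y w, xi w)) by exact: measurable_fun_pair.
have mC' : measurable (xi' @^-1` C) by rewrite -[X in measurable X]setTI; exact: mxi'.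
pose Y' : {mfun T >-> E} := mfun_Sub (mem_set mY).
pose Yxi' : {mfun T >-> (E * F)%type} := mfun_Sub (mem_set mYxi).
have lawD : (distribution Pr Y' \x nu) D = distribution Pr Yxi' D.
  by apply: product_measure_unique => // *; exact: indep_draw_fst.
(* The comparison below divides by nu C; if nu C = 0, both sides vanish. *)
have [C0|C0] := eqVneq (nu C) 0.
  rewrite C0 mule0; apply/eqP; rewrite eq_le measure_ge0 andbT.
  have <- : Pr (xi' @^-1` C) = 0.
    have := law3 measurableT measurableT mC.
    by rewrite !preimage_setT !setTI C0 mule0.
  apply: le_measure; rewrite ?inE//; apply: measurableI => //.
  by rewrite -[X in measurable X]setTI; apply: (mYxi).
pose p := fine (nu C).
have nuC : nu C = p%:E by rewrite fineK// fin_num_measure.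
have p0 : (0 < p)%R.
  by rewrite lt_neqAle -lee_fin -nuC measure_ge0 andbT eq_sym -eqe -nuC.
have p0' : (0 <= p^-1)%R by rewrite invr_ge0 ltW.
(* The law of (Y, xi) conditioned on the event that xi' lies in C. *)
pose m' := mscale (NngNum p0')
  (measure_function_pushforward__canonical__measure_function_Measure
    (mrestr Pr mC') (measurable_funPT Yxi')).
have m'E A : m' A = p^-1%:E * Pr ((fun w => (Y w, xi w)) @^-1` A `&` xi' @^-1` C) by [].
have : (distribution Pr Y' \x nu) D = m' D.
  apply: product_measure_unique => // A B mA mB.
  transitivity (p^-1%:E * Pr (Y @^-1` A `&` xi @^-1` B `&` xi' @^-1` C)); first by [].
  by rewrite law3// nuC muleC -muleA -EFinM divff ?gt_eqF// mule1.
rewrite lawD m'E => lawE.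
rewrite [X in X * _](_ : _ = distribution Pr Yxi' D)// lawE nuC muleAC -EFinM mulVf ?gt_eqF//.
by rewrite mul1e.
Qed.

Variables (h : E * F -> R) (mh : measurable_fun setT h).
Variables (Z : T -> R) (M : R).
Hypothesis Z_cond_exp :
  is_cond_exp Pr (g_sigma_algebra_preimage Y) (fun w => h (Y w, xi w)) Z.
Hypothesis Z_bounded : {ae Pr, forall w, (`|Z w| <= M)%R}.
Hypothesis sq_int : Pr.-integrable setT (fun w => (h (Y w, xi w) ^+ 2)%:E).
Hypothesis sq_int' : Pr.-integrable setT (fun w => (h (Y w, xi' w) ^+ 2)%:E).

Let mU : measurable_fun setT (fun w => h (Y w, xi w)).
Proof. by apply: measurableT_comp => //; exact: measurable_fun_pair. Qed.

Let mV : measurable_fun setT (fun w => h (Y w, xi' w)).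
Proof. by apply: measurableT_comp => //; exact: measurable_fun_pair. Qed.

Lemma integrable_cross : Pr.-integrable setT (fun w => (h (Y w, xi w) * h (Y w, xi' w))%:E).
Proof.
apply: (le_integrable _ _ _ (integrableD measurableT sq_int sq_int')) => //.
  by apply/measurable_EFinP/measurable_funM.
move=> w _ /=; rewrite lee_fin [leRHS]ger0_norm ?addr_ge0 ?sqr_ge0// ler_norml.
have := sqr_ge0 (h (Y w, xi w) + h (Y w, xi' w)).
have := sqr_ge0 (h (Y w, xi w) - h (Y w, xi' w)).
have := sqr_ge0 (h (Y w, xi w)); have := sqr_ge0 (h (Y w, xi' w)).
by rewrite sqrrB sqrrD; lra.
Qed.

Lemma integral_cross :
  \int[Pr]_w (h (Y w, xi w) * h (Y w, xi' w))%:E = \int[Pr]_w (Z w ^+ 2)%:E.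
Proof.
have [iU iZ GZ UZ] := Z_cond_exp.
have mZ : measurable_fun setT Z by have /measurable_int/measurable_EFinP := iZ.
have mhE : measurable_fun setT (EFin \o h) by exact/measurable_EFinP.
have Zb := cond_exp_freeze mY mxi indep_draw_fst mh Z_cond_exp.
have int_ae := ae_integrable_freeze mY mxi indep_draw_fst mhE iU.
(* Z is replaced by a function of Y. The truncation makes g bounded everywhere, hence h * g(Y)
   integrable, and leaves the almost sure equality with Z intact since |Z| <= M. *)
pose g y := (Num.max (- `|M|) (Num.min `|M| (fine (\int[nu]_z (h (y, z))%:E))))%R.
have mg : measurable_fun setT g.
  apply: measurable_maxr => //; apply: measurable_minr => //.
  apply: measurableT_comp => //.
  exact: (measurable_freeze mY mxi indep_draw_fst mhE iU).
have Zg : {ae Pr, forall w, Z w = g (Y w)}.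
  apply: filterS2 Zb Z_bounded => w; rewrite /g => <- /= ZM.
  have := le_trans ZM (ler_norm M); rewrite ler_norml => /andP[Z1 Z2].
  by rewrite min_r// max_r.
have g_le y : (`|g y| <= `|M|)%R.
  by rewrite /g ler_norml le_max lexx/= ge_max ge_min lexx/= andbT ge0_cp.
(* E[UV] = E[UZ], freezing (Y, xi) *)
have -> : \int[Pr]_w (h (Y w, xi w) * h (Y w, xi' w))%:E =
          \int[Pr]_w (h (Y w, xi w) * g (Y w))%:E.
  pose phi (u : (E * F) * F) := (h u.1 * h (u.1.1, u.2))%:E.
  have mphi : measurable_fun setT phi.
    apply/measurable_EFinP/measurable_funM; first exact: measurableT_comp.
    apply: measurableT_comp => //; apply: measurable_fun_pair => //.
    by apply: measurableT_comp.
  have mYxi := measurable_fun_pair mY mxi.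
  have := integral_freeze mYxi mxi' indep_draw_pair mphi integrable_cross.
  rewrite /phi/= => ->; apply: ae_eq_integral => //.
  - by have /measurable_int := integrable_freeze mYxi mxi' indep_draw_pair mphi integrable_cross.
  - by apply/measurable_EFinP/measurable_funM => //; exact: measurableT_comp.
  apply: filterS3 int_ae Zb Zg => w inu Zw Zgw _ /=.
  rewrite -Zgw EFinM Zw -integralZl//.
(* E[U g(Y)] = E[g(Y)^2], freezing Y *)
pose phi (u : E * F) := (h u * g u.1)%:E.
have mphi : measurable_fun setT phi.
  by apply/measurable_EFinP/measurable_funM => //; exact: measurableT_comp.
have iphi : Pr.-integrable setT (fun w => phi (Y w, xi w)).
  apply: (le_integrable _ _ _ (integrableZl measurableT `|M| iU)) => //.
    by apply/measurable_EFinP/measurable_funM => //; exact: measurableT_comp.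
  by move=> w _; rewrite /phi/= lee_fin !normrM mulrC ler_wpM2r// (le_trans (g_le _))// normr_id.
have := integral_freeze mY mxi indep_draw_fst mphi iphi.
rewrite /phi/= => ->; apply: ae_eq_integral => //.
- by have /measurable_int := integrable_freeze mY mxi indep_draw_fst mphi iphi.
- by apply/measurable_EFinP/measurable_funX.
apply: filterS3 int_ae Zb Zg => w inu Zw Zgw _ /=.
rewrite -Zgw; under eq_integral do rewrite EFinM muleC.
by rewrite integralZl//= -Zw -EFinM expr2.
Qed.

End TripleDraw.

(** * Measurability of the iterates *)

Section ProjectionContinuity.
Context {R : realType} {m : nat}.

Lemma eproj_coord_continuous (A : set 'rV[R]_m) j : closed A ->
  convex_set (A : set (convex_lmodType 'rV[R]_m)) -> A !=set0 ->
  continuous (fun y => eproj A y 0 j).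
Proof.
move=> cl cv A0 y; have V z := variational_eproj z cl cv A0.
apply/(@cvgrPdist_le _ _ _ (nbhs y)) => e e0.
have cd : continuous (fun z : 'rV[R]_m => enorm (y - z)).
  move=> z; apply: continuous_comp; last exact: enorm_continuous.
  by apply: (@continuousB _ _ _ (cst y) id); [exact: cst_continuous|exact: cvg_id].
have := cd y => /(@cvgrPdist_le _ _ _ (nbhs y))/(_ e e0).
rewrite subrr enorm0; apply: filterS => z.
rewrite sub0r normrN ger0_norm ?enorm_ge0//; apply: le_trans.
have := le_coord_enorm (eproj A y - eproj A z) j; rewrite !mxE => /le_trans; apply.
by rewrite ler_enorm; exact: variational_nonexpansive (V y) (V z).
Qed.

End ProjectionContinuity.

Section PartialDerivatives.
Context {R : realType} {N : nat} {n : 'I_N -> nat} {d : measure_display}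
  {F : measurableType d}.
Local Notation profile := 'rV[R]_(\sum_(i < N) n i).
Local Notation profileB := (borel_rV R (\sum_(i < N) n i)).

(* A total and measurable function, equal to the partial derivative wherever
   phi is differentiable in the i-th block. *)
Definition partial (phi : profileB * F -> R) (i : 'I_N) (j : 'I_(n i))
    (u : profileB * F) : R :=
  fine (limn_esup (fun k : nat => (k.+1%:R *
    (phi ((u.1 : profile) + k.+1%:R^-1 *: deviate 0 (delta_mx 0 j : 'rV_(n i)), u.2) -
     phi u))%:E)).

Lemma measurable_partial phi i j :
  measurable_fun setT phi -> measurable_fun setT (@partial phi i j).
Proof.
move=> mphi; apply: measurableT_comp => //.
apply: measurable_fun_limn_esup => k; apply/measurable_EFinP.
apply: measurable_funM => //; apply: measurable_funB => //.
apply: (measurableT_comp mphi); apply: measurable_fun_pair => //.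
apply: measurable_rVP => c; rewrite [X in measurable_fun _ X](_ : _ = (fun u : profileB * F =>
  u.1 0 c + (k.+1%:R^-1 *: deviate 0 (delta_mx 0 j : 'rV_(n i)) : profile) 0 c)).
  by apply: measurable_funD => //; apply: (measurableT_comp (measurable_coord_rV c)).
by apply/funext => u; rewrite mxE.
Qed.

Lemma partialE phi i j u :
  differentiable (fun y => phi (deviate u.1 y, u.2)) (submxrow u.1 i) ->
  @partial phi i j u = pgrad i (fun x => phi (x, u.2)) u.1 0 j.
Proof.
move=> df; rewrite /partial /pgrad mxE.
set s := fun k : nat => _.
suff s_cvg : s @ \oo -->
    ('D_(delta_mx 0 j) (fun y => phi (deviate u.1 y, u.2)) (submxrow u.1 i))%:E.
  rewrite is_cvg_limn_esupE; last by apply/cvg_ex; eexists; exact: s_cvg.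
  by rewrite (cvg_lim _ s_cvg).
apply: cvg_EFin; first by exact: nearW.
have := @derive_cvg_seq _ _ _ _ (delta_mx 0 j) df.
rewrite deviate_submxrow -surjective_pairing.
by under eq_fun do rewrite deviate_line.
Qed.

End PartialDerivatives.

Section GameMeasurability.
Context {R : realType} {N : nat} {n : 'I_N -> nat} {p : nat}.
Local Notation profile := 'rV[R]_(\sum_(i < N) n i).
Local Notation profileB := (borel_rV R (\sum_(i < N) n i)).
Local Notation sampleB := (borel_rV R p).
Variable X : forall i, set 'rV[R]_(n i).
Variable ft : 'I_N -> profile -> 'rV[R]_p -> R.
Variable nu : probability sampleB R.
Hypothesis game : stochastic_game X ft nu.
Local Notation f := (objective ft nu).

Lemma measurable_loss i : measurable_fun setT (fun u : profileB * sampleB => ft i u.1 u.2).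
Proof. by have [_ + _ _ _] := game; apply. Qed.

Lemma measurable_objective i : measurable_fun setT (f i : profileB -> R).
Proof.
have mE : measurable_fun setT (fun u : profileB * sampleB => (ft i u.1 u.2)%:E).
  apply/measurable_EFinP; exact: measurable_loss.
apply: measurableT_comp => //.
pose fE := (fun u : profileB * sampleB => (ft i u.1 u.2)%:E).
(* Integrability in z is known for x in X only, so Tonelli is applied to the positive and negative
   parts separately. *)
rewrite [X in measurable_fun _ X](_ : _ = (fun x : profileB =>
    \int[nu]_z (fE^\+ (x, z)) - \int[nu]_z (fE^\- (x, z)))%E); last first.
  apply/funext => x; rewrite [LHS]integralE.
  by congr (_ - _)%E; apply: eq_integral => z _; rewrite ?funeposE ?funenegE.
apply: emeasurable_funB.
- apply: (measurable_fun_fubini_tonelli_F (m2 := nu)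
(fE^\+)%E) => //.
  exact: measurable_funepos.
- apply: (measurable_fun_fubini_tonelli_F (m2 := nu)
(fE^\-)%E) => //.
  exact: measurable_funeneg.
Qed.

Definition sample_partial i j : profileB * sampleB -> R :=
  @partial R N n _ sampleB (fun u => ft i u.1 u.2) i j.

(** Typed on pairs (profile, sample) so that it can be subtracted from [sample_partial] in
    [error_fun]. *)
Definition objective_partial i j : profileB * sampleB -> R :=
  @partial R N n _ sampleB (fun u => f i u.1) i j.

Lemma measurable_sample_partial i j : measurable_fun setT (@sample_partial i j).
Proof. by apply: measurable_partial; exact: measurable_loss. Qed.

Lemma measurable_objective_partial i j : measurable_fun setT (@objective_partial i j).
Proof.
by apply: measurable_partial; exact: (measurableT_comp (measurable_objective i)).
Qed.

Lemma sample_partialE i j x z : profiles X x ->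
  @sample_partial i j (x, z) = pgrad i (fun y => ft i y z) x 0 j.
Proof.
move=> px; apply: partialE; have [_ _ C1 _ _] := game.
by have [+ _] := C1 i x z px; apply; exact: px.
Qed.

Lemma objective_partialE i j x z : profiles X x ->
  @objective_partial i j (x, z) = pgrad i (f i) x 0 j.
Proof. by move=> px; apply: partialE; have [_ _ _ _] := game; exact. Qed.

Section Iterates.
Context {d : measure_display} {Omega : measurableType d}.
Variable Pr : probability Omega R.
Variables (x0 : profile) (gam : nat -> R) (S : nat -> nat).
Variable xi : nat -> 'I_N -> nat -> {RV Pr >-> sampleB}.
Hypothesis px0 : profiles X x0.
Local Notation it := (iterate X ft x0 gam S xi).
Local Notation batch k w := (batch_grad ft S xi k (it k w) w).

Let X_closed i : closed (@X i). Proof. by have [/(_ i)[]] := game. Qed.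
Let X_convex i : convex_set (@X i : set (convex_lmodType 'rV[R]_(n i))).
Proof. by have [/(_ i)[]] := game. Qed.
Let X0 i : @X i !=set0. Proof. by exists (submxrow x0 i). Qed.

Lemma profiles_iterate k w : profiles X (it k w).
Proof.
case: k => //= k i; rewrite mxrowK.
by have [] := variational_eproj (submxrow (it k w) i -
  gam k *: submxrow (batch k w) i) (@X_closed i) (@X_convex i) (@X0 i).
Qed.

Lemma iterateS k w :
  it k.+1 w = eproj (profiles X) (it k w - gam k *: batch k w).
Proof.
rewrite (eproj_eq (variational_eproj_profiles X_closed X_convex _ px0))/=.
by apply: eq_mxrow => i; rewrite submxrowB submxrowZ.
Qed.

Section Measurability.
Context {d' : measure_display} {T : measurableType d'} (phi : T -> Omega).

(** Composing with phi lets one proof serve two sigma-algebras on the same set: phi is the identity,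
    from Omega itself or from Omega equipped with the past. *)
Lemma measurable_batch k :
  measurable_fun setT (it k \o phi : T -> profileB) ->
  (forall i l, (l < S k)%N -> measurable_fun setT (xi k i l \o phi)) ->
  measurable_fun setT ((fun w => batch k w) \o phi : T -> profileB).
Proof.
move=> mit mxi; apply: measurable_rVP => c /=.
pose i := tagnat.sig1 c; pose j := tagnat.sig2 c.
rewrite [X in measurable_fun _ X](_ : _ = fun w => (S k)%:R^-1 *
    \sum_(l < S k) @sample_partial i j (it k (phi w), xi k i l (phi w))).
  apply: measurable_funM => //; apply: measurable_sum => l.
  apply: (measurableT_comp (@measurable_sample_partial i j)).
  by apply: measurable_fun_pair => //; exact: mxi.
apply/funext => w; rewrite !mxE summxE; congr (_ * _); apply: eq_bigr => l _.
by rewrite sample_partialE//; exact: profiles_iterate.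
Qed.

Lemma measurable_iterateS k :
  measurable_fun setT (it k \o phi : T -> profileB) ->
  (forall i l, (l < S k)%N -> measurable_fun setT (xi k i l \o phi)) ->
  measurable_fun setT (it k.+1 \o phi : T -> profileB).
Proof.
move=> mit mxi; have mb := measurable_batch mit mxi.
apply: measurable_rVP => c /=.
pose i := tagnat.sig1 c; pose j := tagnat.sig2 c.
rewrite [X in measurable_fun _ X](_ : _ = (fun y => eproj (@X i) y 0 j) \o
    (fun w => submxrow (it k (phi w)) i - gam k *: submxrow (batch k (phi w)) i)); last first.
  by apply/funext => w; rewrite mxE.
apply: (@measurableT_comp _ _ _ _ (borel_rV R (n i)) _ (fun y => eproj (@X i) y 0 j)).
  by apply: measurable_continuous_rV; exact: eproj_coord_continuous.
apply: measurable_rVP => c'.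
rewrite [X in measurable_fun _ X](_ : _ = (fun w => it k (phi w) 0 (tagnat.Rank i c') -
  gam k * batch k (phi w) 0 (tagnat.Rank i c'))); last first.
  by apply/funext => w; rewrite !mxE.
apply: measurable_funB; first exact: (measurableT_comp (measurable_coord_rV _) mit).
by apply: measurable_funM => //; exact: (measurableT_comp (measurable_coord_rV _) mb).
Qed.

Lemma measurable_iterate K :
  (forall k i l, (k < K)%N -> (l < S k)%N -> measurable_fun setT (xi k i l \o phi)) ->
  measurable_fun setT (it K \o phi : T -> profileB).
Proof.
elim: K => [_|K ih mxi]; first exact: measurable_cst.
apply: measurable_iterateS => [|i l lS]; last exact: mxi.
by apply: ih => k i l kK; apply: mxi; exact: ltnW.
Qed.

Lemma measurable_pseudograd k :
  measurable_fun setT (it k \o phi : T -> profileB) ->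
  measurable_fun setT ((fun w => pseudograd f (it k w)) \o phi : T -> profileB).
Proof.
move=> mit; apply: measurable_rVP => c /=.
pose i := tagnat.sig1 c; pose j := tagnat.sig2 c.
rewrite [X in measurable_fun _ X](_ : _ = fun w =>
    @objective_partial i j (it k (phi w), 0)).
  apply: (measurableT_comp (@measurable_objective_partial i j)).
  exact: measurable_fun_pair.
apply/funext => w; rewrite !mxE objective_partialE; first by rewrite mxE.
exact: profiles_iterate.
Qed.

Lemma measurable_residual k (v : Omega -> profile) :
  measurable_fun setT (it k \o phi : T -> profileB) ->
  measurable_fun setT (v \o phi : T -> profileB) ->
  measurable_fun setT (fun w => enorm (residual X (gam k) (it k (phi w)) (v (phi w))) ^+ 2).
Proof.
move=> mit mv.
have mit' c : measurable_fun setT (fun w => it k (phi w) 0 c).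
  exact: (measurableT_comp (measurable_coord_rV c) mit).
have mv' c : measurable_fun setT (fun w => v (phi w) 0 c).
  exact: (measurableT_comp (measurable_coord_rV c) mv).
rewrite [X in measurable_fun _ X](_ : _ = fun w => \sum_c
  ((gam k)^-1 * (it k (phi w) 0 c -
    eproj (@X (tagnat.sig1 c)) (submxrow (it k (phi w) - gam k *: v (phi w)) (tagnat.sig1 c))
      0 (tagnat.sig2 c))) ^+ 2).
  apply: measurable_sum => c; apply: measurable_funX; apply: measurable_funM => //.
  apply: measurable_funB => //.
  apply: (@measurableT_comp _ _ _ _ (borel_rV R (n (tagnat.sig1 c))) _
    (fun y => eproj (@X (tagnat.sig1 c)) y 0 (tagnat.sig2 c))).
    by apply: measurable_continuous_rV; exact: eproj_coord_continuous.
  apply: measurable_rVP => c'.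
  under eq_fun do rewrite !mxE.
  by apply: measurable_funB => //; apply: measurable_funM.
apply/funext => w; rewrite sqr_enorm /residual.
rewrite (eproj_eq (variational_eproj_profiles X_closed X_convex _ px0)).
by apply: eq_bigr => c _; rewrite -expr2 !mxE.
Qed.

End Measurability.
End Iterates.
End GameMeasurability.

(** * The mean square error of a batch *)

Section MutualIndependence.
Context {d : measure_display} {T : measurableType d} {R : realType}.
Variable Pr : probability T R.

Lemma mutually_independent2 (I : finType) (G : I -> set (set T)) (i j : I)
    (A B : set T) :
  mutually_independent Pr G -> i != j -> G i A -> G j B ->
  Pr (A `&` B) = (Pr A * Pr B)%E.
Proof.
move=> ind ij GA GB.
pose D o := if o == i then A else B.
have Di : D i = A by rewrite /D eqxx.
have Dj : D j = B by rewrite /D eq_sym (negbTE ij).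
have := ind [set i; j]%SET D.
rewrite (bigD1 i) ?inE ?eqxx//= (bigD1 j) ?inE ?eqxx ?orbT ?(eq_sym j i) ?ij//=.
rewrite big_pred0 => [|o]; last by rewrite !inE; case: (o == i); case: (o == j).
rewrite mule1 Di Dj => <-.
  congr (Pr _); apply/seteqP; split=> [w [Aw Bw] o /=|w H].
    by rewrite !inE => /orP[] /eqP ->; rewrite ?Di ?Dj.
  by split; [rewrite -Di|rewrite -Dj]; apply: H; rewrite /= !inE eqxx ?orbT.
by move=> o; rewrite !inE => /orP[] /eqP ->; rewrite ?Di ?Dj.
Qed.

Lemma mutually_independent3 (I : finType) (G : I -> set (set T)) (i j k : I)
    (A B C : set T) :
  mutually_independent Pr G -> i != j -> i != k -> j != k ->
  G i A -> G j B -> G k C ->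
  Pr (A `&` B `&` C) = (Pr A * Pr B * Pr C)%E.
Proof.
move=> ind ij ik jk GA GB GC.
pose D o := if o == i then A else if o == j then B else C.
have Di : D i = A by rewrite /D eqxx.
have Dj : D j = B by rewrite /D eq_sym (negbTE ij) eqxx.
have Dk : D k = C by rewrite /D eq_sym (negbTE ik) eq_sym (negbTE jk).
have := ind [set i; j; k]%SET D.
rewrite (bigD1 i) ?inE ?eqxx//= (bigD1 j) ?inE ?eqxx ?orbT ?(eq_sym j i) ?ij//=.
rewrite (bigD1 k) ?inE ?eqxx ?orbT ?(eq_sym k i) ?ik ?(eq_sym k j) ?jk//=.
rewrite big_pred0 => [|o]; last first.
  by rewrite !inE; case: (o == i); case: (o == j); case: (o == k).
rewrite mule1 Di Dj Dk muleA => <-.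
  congr (Pr _); apply/seteqP; split=> [w [[Aw Bw] Cw] o /=|w H].
    by rewrite !inE -orbA => /or3P[] /eqP ->; rewrite ?Di ?Dj ?Dk.
  by split; [split|]; [rewrite -Di|rewrite -Dj|rewrite -Dk]; apply: H; rewrite /= !inE eqxx ?orbT.
by move=> o; rewrite !inE -orbA => /or3P[] /eqP ->; rewrite ?Di ?Dj ?Dk.
Qed.

End MutualIndependence.

Section Past.
Context {R : realType} {N : nat} {n : 'I_N -> nat} {p : nat}.
Local Notation profile := 'rV[R]_(\sum_(i < N) n i).
Local Notation profileB := (borel_rV R (\sum_(i < N) n i)).
Local Notation sampleB := (borel_rV R p).
Variable X : forall i, set 'rV[R]_(n i).
Variable ft : 'I_N -> profile -> 'rV[R]_p -> R.
Variable nu : probability sampleB R.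
Hypothesis game : stochastic_game X ft nu.
Local Notation f := (objective ft nu).
Context {d : measure_display} {Omega : measurableType d}.
Variable Pr : probability Omega R.
Variables (x0 : profile) (gam : nat -> R) (S : nat -> nat).
Variable xi : nat -> 'I_N -> nat -> {RV Pr >-> sampleB}.
Hypothesis px0 : profiles X x0.
Local Notation it := (iterate X ft x0 gam S xi).
Local Notation batch k w := (batch_grad ft S xi k (it k w) w).

(** Omega with [past S xi K] as its measurable sets: being determined by the past becomes plain
    measurability. *)
Definition pastT (K : nat) := g_sigma_algebraType
  [set A | exists j i l, [/\ (j < K)%N, (l < S j)%N &
                               g_sigma_algebra_preimage (xi j i l) A]].

Lemma measurable_past_sample K j i l : (j < K)%N -> (l < S j)%N ->
  measurable_fun setT (xi j i l \o id : pastT K -> sampleB).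
Proof.
move=> jK lS _ B mB; apply: sub_sigma_algebra; exists j, i, l; split=> //.
by exists B.
Qed.

Lemma measurable_past_iterate K k : (k <= K)%N ->
  measurable_fun setT (it k \o id : pastT K -> profileB).
Proof.
move=> kK; apply: (measurable_iterate game gam px0 (phi := (id : pastT K -> Omega))) => j i l jk lS.
by apply: measurable_past_sample => //; exact: leq_trans kK.
Qed.

Lemma measurable_past_batch K k : (k < K)%N ->
  measurable_fun setT ((fun w => batch k w) \o id : pastT K -> profileB).
Proof.
move=> kK; apply: (measurable_batch game px0 (phi := (id : pastT K -> Omega))).
  by apply: measurable_past_iterate; exact: ltnW.
by move=> i l lS; exact: measurable_past_sample.
Qed.

Lemma measurable_it k : measurable_fun setT (it k : Omega -> profileB).
Proof. by apply: (measurable_iterate game gam px0 (phi := id)) => *; exact: measurable_funPT. Qed.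

Local Notation err := (sample_error X ft x0 gam S xi f).

(** The measurable function to be frozen; it gives coordinate j of the true error because the
    iterates stay in X. *)
Definition error_fun i j (u : profileB * sampleB) : R :=
  @sample_partial R N n p ft i j u - @objective_partial R N n p ft nu i j u.

Lemma measurable_error_fun i j : measurable_fun setT (@error_fun i j).
Proof.
apply: measurable_funB; first exact: (measurable_sample_partial game).
exact: (measurable_objective_partial game).
Qed.

Lemma error_funE k i l j w : err k i l w 0 j = @error_fun i j (it k w, xi k i l w).
Proof.
have px := profiles_iterate game gam S xi px0 k w.
rewrite /error_fun (sample_partialE game _ _ px) (objective_partialE game _ _ px).
by rewrite !mxE.
Qed.

Section Moments.
Variables (k : nat) (mu sigma : R).
Hypothesis fresh : fresh_batch S xi nu k.
Hypothesis bias : bias_bound X ft x0 gam S xi f k mu.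
Hypothesis moment2 : second_moment_bound X ft x0 gam S xi f k sigma.

Lemma mean_sq_error i l : (l < S k)%N ->
  Pr.-integrable setT (fun w => (dotv (err k i l w) (err k i l w))%:E) /\
  (\int[Pr]_w (dotv (err k i l w) (err k i l w))%:E <= (sigma ^+ 2)%:E)%E.
Proof.
move=> lS; have [Z [[iY iZ _ YZ] Z_le]] := moment2 i lS.
have E : (fun w => (dotv (err k i l w) (err k i l w))%:E) =
    EFin \o (fun w => enorm (err k i l w) ^+ 2).
  by apply/funext => w /=; rewrite sqr_enorm.
rewrite E; split=> //.
have /= -> := YZ setT; last by exists setT => //; rewrite preimage_setT setTI.
have -> : (sigma ^+ 2)%:E = (\int[Pr]_(w in setT) (sigma ^+ 2)%:E)%E.
  by rewrite integral_cst//= [X in (_ * X)%E]probability_setT mule1.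
have mZ : measurable_fun setT (EFin \o Z) by exact: measurable_int iZ.
(* Z is bounded above almost surely, but its sign is not given; the positive part allows a
   comparison of nonnegative integrals. *)
apply: (@le_trans _ _ (\int[Pr]_w (EFin \o Z)^\+ w)%E).
  apply: le_integral => //; first exact: integrable_funepos.
  by move=> w _; rewrite funeposE le_max lexx.
apply: ae_ge0_le_integral => //.
- exact: measurable_funepos.
- by move=> w _; rewrite lee_fin sqr_ge0.
by apply: filterS Z_le => w /= Zw _; rewrite funeposE ge_max !lee_fin Zw sqr_ge0.
Qed.

Lemma integrable_sq_coord_error i l j : (l < S k)%N ->
  Pr.-integrable setT (fun w => (@error_fun i j (it k w, xi k i l w) ^+ 2)%:E).
Proof.
move=> lS; apply: (le_integrable _ _ _ (mean_sq_error i lS).1) => //.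
  apply/measurable_EFinP/measurable_funX.
  apply: (measurableT_comp (@measurable_error_fun i j)); apply: measurable_fun_pair => //.
  exact: measurable_it.
move=> w _ /=; rewrite lee_fin -error_funE !ger0_norm ?sqr_ge0 ?dotv_ge0//.
rewrite /dotv (bigD1 j)//= -expr2 lerDl.
by apply: sumr_ge0 => c _; rewrite -expr2 sqr_ge0.
Qed.

(** In [fresh_batch] the index [None] carries the past, which determines x^k; with l and l' this
    makes three distinct indices. *)
Lemma triple_law i l l' : (l < S k)%N -> (l' < S k)%N -> l != l' ->
  forall A B C, measurable A -> measurable B -> measurable C ->
  Pr ((it k : Omega -> profileB) @^-1` A `&` xi k i l @^-1` B `&` xi k i l' @^-1` C) =
  (Pr ((it k : Omega -> profileB) @^-1` A) * nu B * nu C)%E.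
Proof.
move=> lS lS' ll' A B C mA mB mC; have [law ind] := fresh i.
rewrite -(law l lS B mB) -(law l' lS' C mC).
apply: (@mutually_independent3 _ _ _ Pr _ _
  None (Some (Ordinal lS)) (Some (Ordinal lS')) _ _ _ ind) => //.
- have := measurable_past_iterate (leqnn k) measurableT mA; rewrite setTI.
  exact.
- by exists B => //; rewrite setTI.
- by exists C => //; rewrite setTI.
Qed.

(** [integral_cross] is used per coordinate, with |Z_j| <= mu only to have boundedness. The
    coordinates are summed before |Z|^2 <= mu^2 is applied, so no dimension factor appears. *)
Lemma mean_cross_error i l l' : (l < S k)%N -> (l' < S k)%N -> l != l' ->
  Pr.-integrable setT (fun w => (dotv (err k i l w) (err k i l' w))%:E) /\
  (\int[Pr]_w (dotv (err k i l w) (err k i l' w))%:E <= (mu ^+ 2)%:E)%E.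
Proof.
move=> lS lS' ll'; have [Z [condZ Z_le]] := bias i lS.
have mit := measurable_it k.
have E : (fun w => (dotv (err k i l w) (err k i l' w))%:E) = (fun w => \sum_j
    (@error_fun i j (it k w, xi k i l w) * @error_fun i j (it k w, xi k i l' w))%:E)%E.
  apply/funext => w; rewrite sumEFin; congr EFin; apply: eq_bigr => j _.
  by rewrite !error_funE.
have law3 := triple_law i lS lS' ll'.
have condZ' j : is_cond_exp Pr (g_sigma_algebra_preimage (it k : Omega -> profileB))
    (fun w => @error_fun i j (it k w, xi k i l w)) (fun w => Z w 0 j).
  have := condZ j; congr (is_cond_exp _ _ _ _).
  by apply/funext => w; rewrite error_funE.
have Zj_le j : {ae Pr, forall w, `|Z w 0 j| <= mu}.
  by apply: filterS Z_le => w; apply: le_trans; exact: le_coord_enorm.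
have icross j := integrable_cross mit (measurable_funPT _) (measurable_funPT _)
  (@measurable_error_fun i j) (@integrable_sq_coord_error i _ j lS)
  (@integrable_sq_coord_error i _ j lS').
have cross j := integral_cross mit (measurable_funPT _) (measurable_funPT _)
  law3 (@measurable_error_fun i j) (condZ' j) (Zj_le j)
  (@integrable_sq_coord_error i _ j lS) (@integrable_sq_coord_error i _ j lS').
rewrite E; split; first by apply: integrable_sum => // j _; exact: icross.
rewrite integral_sum//.
have mZ j : measurable_fun setT (fun w => Z w 0 j).
  by have [_ /measurable_int/measurable_EFinP] := condZ j.
under eq_bigr do rewrite cross.
rewrite -ge0_integral_sum//; first last.
- by move=> j w _; rewrite lee_fin sqr_ge0.
- by move=> j; apply/measurable_EFinP/measurable_funX.
have -> : (mu ^+ 2)%:E = (\int[Pr]_(w in setT) (mu ^+ 2)%:E)%E.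
  by rewrite integral_cst//= [X in (_ * X)%E]probability_setT mule1.
apply: ae_ge0_le_integral => //.
- by move=> w _; apply: sume_ge0 => j _; rewrite lee_fin sqr_ge0.
- by apply: emeasurable_sum => j; apply/measurable_EFinP/measurable_funX.
- by move=> w _; rewrite lee_fin sqr_ge0.
apply: filterS Z_le => w Zw _; rewrite sumEFin lee_fin.
have -> : \sum_j Z w 0 j ^+ 2 = enorm (Z w) ^+ 2.
  by rewrite sqr_enorm; apply: eq_bigr => j _; rewrite expr2.
by rewrite ler_sqr ?nnegrE ?enorm_ge0// (le_trans (enorm_ge0 _) Zw).
Qed.

(** For each player, the square of the mean of S errors has S diagonal terms, at most sigma^2 in
    mean, and S (S - 1) cross terms, at most mu^2 in mean, all divided by S^2. *)
Lemma mean_sq_batch_error : (0 < S k)%N ->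
  Pr.-integrable setT (fun w =>
    (dotv (batch k w - pseudograd f (it k w)) (batch k w - pseudograd f (it k w)))%:E) /\
  (\int[Pr]_w
    (dotv (batch k w - pseudograd f (it k w)) (batch k w - pseudograd f (it k w)))%:E <=
   (N%:R * ((sigma ^+ 2 + ((S k)%:R - 1) * mu ^+ 2) / (S k)%:R))%:E)%E.
Proof.
move=> S0; have S0' : (S k)%:R != 0 :> R by rewrite pnatr_eq0 -lt0n.
have E : (fun w =>
    (dotv (batch k w - pseudograd f (it k w)) (batch k w - pseudograd f (it k w)))%:E) =
  (fun w => \sum_(i < N) \sum_(l < S k) \sum_(l' < S k)
    ((S k)%:R^-2)%:E * (dotv (err k i l w) (err k i l' w))%:E)%E.
  apply/funext => w; rewrite dotv_submxrow -sumEFin; apply: eq_bigr => i _.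
  rewrite submxrowB /batch_grad /pseudograd !mxrowK.
  have -> : (S k)%:R^-1 *: (\sum_(l < S k) sample_grad ft xi k i l (it k w) w) -
      pgrad i (f i) (it k w) = (S k)%:R^-1 *: \sum_(l < S k) err k i l w.
    rewrite /sample_error sumrB scalerBr sumr_const card_ord -scalerMnr scalerMnl.
    by rewrite -[_^-1 *+ _]mulr_natr mulVf// scale1r.
  have dotv_suml (m : nat) (v : 'I_(S k) -> 'rV[R]_m) u :
      dotv (\sum_l v l) u = \sum_l dotv (v l) u.
    apply: (big_morph (fun v => dotv v u) (id1 := 0)) => [a b|]; first by rewrite dotvDl.
    by rewrite -(scale0r (0 : 'rV[R]_m)) dotvZl mul0r.
  rewrite dotvZl dotvZr mulrA -expr2 exprVn dotv_suml.
  rewrite mulr_sumr -sumEFin; apply: eq_bigr => l _.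
  rewrite dotvC dotv_suml mulr_sumr -sumEFin; apply: eq_bigr => l' _.
  by rewrite dotvC.
have ierr i (l l' : 'I_(S k)) :
    Pr.-integrable setT (fun w => (dotv (err k i l w) (err k i l' w))%:E).
  have [->|ll'] := eqVneq l l'; first by have [] := mean_sq_error i (ltn_ord l').
  by have [] := mean_cross_error i (ltn_ord l) (ltn_ord l') ll'.
rewrite E; split.
  do 3 (apply: integrable_sum => // ? _); exact: integrableZl.
rewrite integral_sum// => [|i]; last first.
  do 2 (apply: integrable_sum => // ? _); exact: integrableZl.
apply: (@le_trans _ _ (\sum_(i < N)
   ((sigma ^+ 2 + ((S k)%:R - 1) * mu ^+ 2) / (S k)%:R)%:E)%E); last first.
  by rewrite sumEFin sumr_const card_ord mulr_natl.
apply: lee_sum => i _.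
rewrite integral_sum// => [|l]; last first.
  apply: integrable_sum => // ? _; exact: integrableZl.
apply: (@le_trans _ _ (\sum_(l < S k)
   ((sigma ^+ 2 + ((S k)%:R - 1) * mu ^+ 2) / (S k)%:R ^+ 2)%:E)%E); last first.
  rewrite sumEFin sumr_const card_ord lee_fin -mulr_natr le_eqVlt; apply/orP; left; apply/eqP.
  by field.
apply: lee_sum => l _.
rewrite integral_sum// => [|l']; last exact: integrableZl.
rewrite (bigD1 l)//= [X in (_ + X)%E](_ : _ = \sum_(l' < S k | l' != l)
   ((S k)%:R^-2)%:E * \int[Pr]_w (dotv (err k i l w) (err k i l' w))%:E)%E; last first.
  by apply: eq_bigr => l' _; rewrite integralZl.
rewrite integralZl//.
apply: (@le_trans _ _ (((S k)%:R^-2)%:E * (sigma ^+ 2)%:E +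
   \sum_(l' < S k | l' != l) ((S k)%:R^-2)%:E * (mu ^+ 2)%:E)%E).
  apply: leeD.
    by apply: lee_wpmul2l; [rewrite lee_fin invr_ge0 sqr_ge0|exact: (mean_sq_error i (ltn_ord l)).2].
  apply: lee_sum => l' ll'; apply: lee_wpmul2l; first by rewrite lee_fin invr_ge0 sqr_ge0.
  by apply: (mean_cross_error i (ltn_ord l) (ltn_ord l') _).2; rewrite eq_sym.
rewrite sumEFin sumr_const -!EFinM -EFinD lee_fin -[_ *+ #|_|]mulr_natr.
have -> : #|(fun l' : 'I_(S k) => l' != l)| = (S k).-1.
  by have := cardC1 l; rewrite card_ord.
rewrite le_eqVlt; apply/orP; left; apply/eqP.
have -> : ((S k).-1)%:R = (S k)%:R - 1 :> R by rewrite -[in RHS](prednK S0) -natr1 addrK.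
by field.
Qed.

End Moments.

End Past.

(** * The random output index *)

Section RandomIndex.
Local Open Scope ereal_scope.
Context {d : measure_display} {T : measurableType d} {R : realType}.
Variable Pr : probability T R.

Variables (K : nat) (G : set (set T)) (Rk : {RV Pr >-> nat}) (phi : nat -> T -> R)
  (a : nat -> R).
Hypothesis Rk_indep : mutually_independent Pr
  (fun b : bool => if b then g_sigma_algebra_preimage Rk else G).
Hypothesis Rk_pmf : forall k, (1 <= k <= K)%N -> Pr (Rk @^-1` [set k]) = (a k)%:E.
Hypothesis sum_a : (\sum_(1 <= k < K.+1) a k = 1)%R.
Hypothesis phi_ge0 : forall k w, (0 <= phi k w)%R.
Hypothesis mphi : forall k, measurable_fun setT (phi k).
Hypothesis phi_past : forall k, (1 <= k <= K)%N ->
  forall B, measurable B -> G (phi k @^-1` B).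

Let mRk k : measurable (Rk @^-1` [set k]).
Proof. by rewrite -[X in measurable X]setTI; exact: measurable_funPT. Qed.

(** Freezing with Rk as the draw and its own law as nu. The nonnegative version is used, so the
    integral of [phi k] may be infinite. *)
Lemma integral_indep_index k : (1 <= k <= K)%N ->
  \int[Pr]_w (phi k w * \1_(Rk @^-1` [set k]) w)%:E = (a k)%:E * \int[Pr]_w (phi k w)%:E.
Proof.
move=> kK.
have ind : indep_draw Pr (distribution Pr Rk) (phi k) Rk.
  move=> A B mA mB; rewrite setIC muleC.
  apply: (mutually_independent2 (i := true) (j := false) Rk_indep) => //.
    by exists B => //; rewrite setTI.
  exact: phi_past.
(* The absolute value makes F nonnegative on all of R; it disappears at [phi k], which is
   nonnegative. *)
pose F (u : R * nat) := (`|u.1| * \1_[set k] u.2)%:E.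
have mF : measurable_fun setT F.
  apply/measurable_EFinP/measurable_funM; first exact: measurableT_comp.
  by apply: measurableT_comp => //; exact: measurable_indic.
have F0 u : 0 <= F u by rewrite lee_fin mulr_ge0.
have := ge0_integral_freeze (mphi k) (measurable_funPT _) ind mF F0.
rewrite /F/= => H.
transitivity (\int[Pr]_x (`|phi k x| * \1_[set k] (Rk x))%:E).
  by apply: eq_integral => w _; rewrite ger0_norm.
rewrite H -ge0_integralZl//; last 3 first.
- exact/measurable_EFinP.
- by move=> w _; rewrite lee_fin.
- by rewrite -Rk_pmf.
apply: eq_integral => w _.
under eq_integral do rewrite EFinM.
rewrite ge0_integralZl//.
rewrite integral_indic// setIT ger0_norm// muleC; congr (_ * _).
by rewrite -Rk_pmf.
Qed.

Lemma expectation_random_index :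
  'E_Pr[fun w => phi (Rk w) w] = \sum_(1 <= k < K.+1) (a k)%:E * \int[Pr]_w (phi k w)%:E.
Proof.
(* The event that Rk lies in 1..K. The prescribed probabilities add up to 1, so values outside have
   probability 0. *)
pose D := \big[setU/set0]_(k < K) Rk @^-1` [set k.+1].
have mD : measurable D by exact: bigsetU_measurable.
have PrD : Pr D = 1.
  rewrite /D (measure_bigsetU Pr (fun k => mRk k.+1)); last first.
    apply/trivIsetP => i j _ _ ij; apply/seteqP; split=> // w /= [-> [ji]].
    by rewrite ji eqxx in ij.
  rewrite (eq_bigr (fun k : 'I_K => (a k.+1)%:E)) => [|k _]; last by apply: Rk_pmf; rewrite ltn_ord.
  by rewrite sumEFin -sum_a big_add1/= big_mkord.
have PrDC : Pr (~` D) = 0 by rewrite probability_setC// PrD subee.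
have mR : measurable_fun setT (fun w => phi (Rk w) w).
  move=> _ B mB; rewrite setTI.
  rewrite [X in measurable X](_ : _ = \bigcup_k (Rk @^-1` [set k] `&` phi k @^-1` B)).
    apply: bigcupT_measurable => k; apply: measurableI => //.
    by rewrite -[X in measurable X]setTI; exact: mphi.
  by apply/seteqP; split=> [w /= Bw|w [k _ [/= <-]]//]; exists (Rk w).
have mterm k : measurable_fun setT (fun w => phi k w * \1_(Rk @^-1` [set k]) w)%R.
  by apply: measurable_funM => //; exact: measurable_indic.
rewrite unlock.
transitivity (\int[Pr]_w \sum_(1 <= k < K.+1) (phi k w * \1_(Rk @^-1` [set k]) w)%:E).
  apply: ae_eq_integral => //.
  - exact/measurable_EFinP.
  - by apply: emeasurable_sum => k; exact/measurable_EFinP.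
  exists (~` D); split=> //; first exact: measurableC.
  apply: subsetC => w Dw _.
  have {Dw} [k kK Rw] : exists2 k, (1 <= k < K.+1)%N & Rk w = k.
    move: Dw; rewrite /D -(bigcup_mkord K (fun k => Rk @^-1` [set k.+1])) => -[k /= kK Rw].
    by exists k.+1.
  rewrite sumEFin; congr EFin; rewrite Rw.
  rewrite (bigD1_seq k) ?mem_index_iota ?iota_uniq//= indicE mem_set ?mulr1//.
  rewrite big1 ?addr0// => j jk; rewrite indicE memNset ?mulr0//= => jR.
  by rewrite -Rw jR eqxx in jk.
rewrite ge0_integral_sum//.
- rewrite !big_nat; apply: eq_bigr => k kK; apply: integral_indep_index.
  by move: kK; rewrite ltnS.
- by move=> k; exact/measurable_EFinP.
- by move=> k w _; rewrite lee_fin mulr_ge0.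
Qed.

End RandomIndex.

(** * The two residuals of a run *)

(** 2 |r|^2 + 2 |r - s|^2 - |s|^2 = |s - 2 r|^2, and the same with r and s exchanged. *)
Lemma dotv_triangle2 (R : realType) m (r s : 'rV[R]_m) (q : R) :
  dotv (r - s) (r - s) <= q ->
  dotv s s <= 2 * dotv r r + 2 * q /\ dotv r r <= 2 * dotv s s + 2 * q.
Proof.
have := dotv_ge0 (r - 2 *: s); have := dotv_ge0 (s - 2 *: r).
by rewrite !dotvE (dotvC s r); lra.
Qed.

(** The support of P_R starts at 1, so the telescoping starts at [q 1]. *)
Lemma le_sum_telescope (R : realType) (a b c q : nat -> R) :
  (forall k, a k <= q k - q k.+1 + b k + c k) -> forall K,
  \sum_(k < K) a k.+1 <=
  q 1 - q K.+1 + \sum_(k < K) b k.+1 + \sum_(k < K) c k.+1.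
Proof.
move=> le_k; elim=> [|K ih]; first by rewrite !big_ord0 subrr !addr0.
by rewrite !big_ord_recr/=; have := le_k K.+1; lra.
Qed.

Section IntegralInequality.
Context {d : measure_display} {T : measurableType d} {R : realType}.
Variable Pr : probability T R.

Lemma integral_sumZl (K : nat) (a U : 'I_K -> R) (u : 'I_K -> T -> R) :
  (forall k, Pr.-integrable setT (EFin \o u k)) ->
  (forall k, (\int[Pr]_w (u k w)%:E)%E = (U k)%:E) ->
  Pr.-integrable setT (fun w => (\sum_k a k * u k w)%:E) /\
  (\int[Pr]_w (\sum_k a k * u k w)%:E)%E = (\sum_k a k * U k)%:E.
Proof.
move=> iu uU.
have E : (fun w => (\sum_k a k * u k w)%:E) = (fun w => \sum_k (a k)%:E * (u k w)%:E)%E.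
  by apply/funext => w; rewrite -sumEFin; apply: eq_bigr.
have iau k : Pr.-integrable setT (fun w => ((a k)%:E * (u k w)%:E)%E).
  exact: (integrableZl measurableT (a k) (iu k)).
rewrite E; split; first exact: integrable_sum.
rewrite integral_sum// -sumEFin; apply: eq_bigr => k _.
by rewrite EFinM -uU; exact: (integralZl measurableT (iu k)).
Qed.

Lemma le_sum_integral (K : nat) (a b c A B C : 'I_K -> R) (u v z : 'I_K -> T -> R) (C0 : R) :
  (forall k, Pr.-integrable setT (EFin \o u k)) ->
  (forall k, Pr.-integrable setT (EFin \o v k)) ->
  (forall k, Pr.-integrable setT (EFin \o z k)) ->
  (forall k, (\int[Pr]_w (u k w)%:E)%E = (A k)%:E) ->
  (forall k, (\int[Pr]_w (v k w)%:E)%E = (B k)%:E) ->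
  (forall k, (\int[Pr]_w (z k w)%:E)%E = (C k)%:E) ->
  (forall w, \sum_k a k * u k w <= C0 + \sum_k b k * v k w + \sum_k c k * z k w) ->
  \sum_k a k * A k <= C0 + \sum_k b k * B k + \sum_k c k * C k.
Proof.
move=> iu iv iz uA vB zC le_w.
have [iau auA] := integral_sumZl a iu uA.
have [ibv bvB] := integral_sumZl b iv vB.
have [icz czC] := integral_sumZl c iz zC.
have iC0 : Pr.-integrable setT (fun=> C0%:E) by exact: finite_measure_integrable_cst.
rewrite -lee_fin !EFinD -auA -bvB -czC.
have -> : C0%:E = (\int[Pr]_(w in setT) C0%:E)%E.
  by rewrite integral_cst//= [X in (_ * X)%E]probability_setT mule1.
rewrite -integralD// -integralD//; last exact: integrableD.
apply: le_integral => //; first by apply: integrableD => //; exact: integrableD.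
by move=> w _; rewrite -!EFinD lee_fin.
Qed.

Lemma le_integral_comb (b c A B C : R) (u v z : T -> R) :
  Pr.-integrable setT (EFin \o u) -> Pr.-integrable setT (EFin \o v) ->
  Pr.-integrable setT (EFin \o z) ->
  (\int[Pr]_w (u w)%:E)%E = A%:E -> (\int[Pr]_w (v w)%:E)%E = B%:E ->
  (\int[Pr]_w (z w)%:E)%E = C%:E ->
  (forall w, u w <= b * v w + c * z w) -> A <= b * B + c * C.
Proof.
move=> iu iv iz uA vB zC le_w.
have := @le_sum_integral 1 (fun=> 1) (fun=> b) (fun=> c) (fun=> A) (fun=> B) (fun=> C)
  (fun=> u) (fun=> v) (fun=> z) 0.
rewrite !big_ord1 mul1r add0r; apply=> // w.
by rewrite !big_ord1 mul1r add0r.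
Qed.

End IntegralInequality.

Section Run.
Context {R : realType} {N : nat} {n : 'I_N -> nat} {p : nat}.
Local Notation profile := 'rV[R]_(\sum_(i < N) n i).
Local Notation profileB := (borel_rV R (\sum_(i < N) n i)).
Local Notation sampleB := (borel_rV R p).
Variable X : forall i, set 'rV[R]_(n i).
Variable ft : 'I_N -> profile -> 'rV[R]_p -> R.
Variable nu : probability sampleB R.
Hypothesis game : stochastic_game X ft nu.
Local Notation f := (objective ft nu).
Variables (P : profile -> R) (L Pmax Pmin : R).
Hypothesis L_gt0 : 0 < L.
Hypothesis f_P : is_potential X f P.
Hypothesis P_smooth : smooth_on (profiles X) L P.
Hypothesis P_le : forall y, profiles X y -> P y <= Pmax.
Hypothesis P_ge : forall y, profiles X y -> Pmin <= P y.
Context {d : measure_display} {Omega : measurableType d}.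
Variable Pr : probability Omega R.
Variables (x0 : profile) (gam : nat -> R) (S : nat -> nat).
Variable xi : nat -> 'I_N -> nat -> {RV Pr >-> sampleB}.
Variables (mu sigma : nat -> R) (K : nat) (Rk : {RV Pr >-> nat}).
Hypothesis run : rsg_run X ft x0 gam S xi nu L K mu sigma Rk.
Local Notation it := (iterate X ft x0 gam S xi).
Local Notation batch k w := (batch_grad ft S xi k (it k w) w).

Let X_closed i : closed (@X i). Proof. by have [/(_ i)[]] := game. Qed.
Let X_convex i : convex_set (@X i : set (convex_lmodType 'rV[R]_(n i))).
Proof. by have [/(_ i)[]] := game. Qed.
Let px0 : profiles X x0. Proof. by have [] := run. Qed.
Let px k w : profiles X (it k w).
Proof. exact: (profiles_iterate game). Qed.
Let gam_gt0 k : 0 < gam k. Proof. by have [_ _ /(_ k)[]] := run. Qed.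
Let f_diff i x : profiles X x ->
  differentiable (fun z => f i (deviate x z)) (submxrow x i).
Proof. by have [_ _ _ _] := game; exact. Qed.

Let weight k := gam k - L * gam k ^+ 2.

(** This is where the stepsize bound enters: it says L * gam k <= 1 / 2. *)
Lemma half_le_weight k : gam k / 2 <= weight k.
Proof.
have [_ _ /(_ k)[g0 gL] _ _] := run.
have : L * gam k <= 1 / 2.
  have -> : 1 / 2 = L * (1 / (2 * L)) by field; rewrite gt_eqF.
  by rewrite ler_pM2l.
rewrite -(ler_pM2r g0) /weight expr2 mulrA; lra.
Qed.

Let weight_gt0 k : 0 < weight k.
Proof. by rewrite (lt_le_trans _ (half_le_weight k))// divr_gt0. Qed.

Definition sq_residual k w := enorm (residual X (gam k) (it k w) (pseudograd f (it k w))) ^+ 2.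
Definition sq_sample_residual k w := enorm (residual X (gam k) (it k w) (batch k w)) ^+ 2.
Definition sq_error k w :=
  dotv (batch k w - pseudograd f (it k w)) (batch k w - pseudograd f (it k w)).
Definition error_bound k : R :=
  N%:R * ((sigma k ^+ 2 + ((S k)%:R - 1) * mu k ^+ 2) / (S k)%:R).

Lemma sq_residualE k w : sq_residual k w =
  dotv (residual X (gam k) (it k w) (pseudograd f (it k w)))
       (residual X (gam k) (it k w) (pseudograd f (it k w))).
Proof. exact: sqr_enorm. Qed.

Lemma sq_sample_residualE k w : sq_sample_residual k w =
  dotv (residual X (gam k) (it k w) (batch k w)) (residual X (gam k) (it k w) (batch k w)).
Proof. exact: sqr_enorm. Qed.

Lemma measurable_sq_residual k : measurable_fun setT (sq_residual k).
Proof.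
have mit := measurable_it game gam S xi px0 k.
have mF := measurable_pseudograd game px0 (T := Omega) (phi := id) mit.
exact: (measurable_residual game px0 (T := Omega) (phi := id) mit mF).
Qed.

Lemma measurable_sq_sample_residual k : measurable_fun setT (sq_sample_residual k).
Proof.
have mit := measurable_it game gam S xi px0 k.
have mF := measurable_batch game px0 (T := Omega) (phi := id) mit
  (fun i l _ => measurable_funPT (xi k i l)).
exact: (measurable_residual game px0 (T := Omega) (phi := id) mit mF).
Qed.

Lemma past_sq_residual k B : (k <= K)%N -> measurable B ->
  past S xi K.+1 (sq_residual k @^-1` B).
Proof.
move=> kK mB.
have mit : measurable_fun setT (it k \o id : pastT S xi K.+1 -> profileB).
  exact: (measurable_past_iterate game gam px0 (leqW kK)).
have mF := measurable_pseudograd game px0 mit.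
by have := measurable_residual game px0 mit mF measurableT mB; rewrite setTI.
Qed.

(** The residual at k = K involves the batch drawn at K, hence the past of K.+1. *)
Lemma past_sq_sample_residual k B : (k <= K)%N -> measurable B ->
  past S xi K.+1 (sq_sample_residual k @^-1` B).
Proof.
move=> kK mB.
have mit : measurable_fun setT (it k \o id : pastT S xi K.+1 -> profileB).
  exact: (measurable_past_iterate game gam px0 (leqW kK)).
have mF : measurable_fun setT ((fun w => batch k w) \o id : pastT S xi K.+1 -> profileB).
  exact: (measurable_past_batch game gam px0 (kK : (k < K.+1)%N)).
by have := measurable_residual game px0 mit mF measurableT mB; rewrite setTI.
Qed.

Lemma sq_residual_bounded k w : weight k * sq_residual k w <= Pmax - Pmin.
Proof.
rewrite sq_residualE; apply: (le_trans (residual_bounded X_closed X_convex f_P P_smooth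
  f_diff L_gt0 (gam_gt0 k) (px k w) P_ge)).
by rewrite lerB// P_le.
Qed.

Lemma integrable_sq_residual k : Pr.-integrable setT (EFin \o sq_residual k).
Proof.
apply: (le_integrable _ _ _
  (finite_measure_integrable_cst Pr ((Pmax - Pmin) / weight k) measurableT)) => //.
  exact/measurable_EFinP/measurable_sq_residual.
move=> w _ /=; rewrite lee_fin ger0_norm ?sqr_ge0// (le_trans _ (ler_norm _))//.
by rewrite ler_pdivlMr// mulrC sq_residual_bounded.
Qed.

Lemma integrable_sq_error k : (k <= K)%N ->
  Pr.-integrable setT (EFin \o sq_error k) /\
  (\int[Pr]_w (sq_error k w)%:E <= (error_bound k)%:E)%E.
Proof.
move=> kK; have [_ _ _ S0 [fresh _ _ bias moment]] := run.
have [_ bk] := bias k kK; have [_ mk] := moment k kK.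
exact: (mean_sq_batch_error game px0 (fresh k kK) bk mk (S0 k)).
Qed.

Lemma sq_residual_triangle k w :
  sq_residual k w <= 2 * sq_sample_residual k w + 2 * sq_error k w /\
  sq_sample_residual k w <= 2 * sq_residual k w + 2 * sq_error k w.
Proof.
rewrite sq_residualE sq_sample_residualE; apply: dotv_triangle2.
exact: (residual_nonexpansive X_closed X_convex (gam_gt0 k) (px k w)).
Qed.

Lemma integrable_sq_sample_residual k : (k <= K)%N ->
  Pr.-integrable setT (EFin \o sq_sample_residual k).
Proof.
move=> kK.
apply: (le_integrable _ _ _ (integrableD measurableT
  (integrableZl measurableT 2 (integrable_sq_residual k))
  (integrableZl measurableT 2 (integrable_sq_error kK).1))) => //.
  exact/measurable_EFinP/measurable_sq_sample_residual.
move=> w _ /=; rewrite lee_fin ger0_norm ?sqr_ge0// (le_trans _ (ler_norm _))//.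
by have [] := sq_residual_triangle k w.
Qed.

Lemma step_descent k w (c : R) : 0 < c ->
  weight k * sq_sample_residual k w <=
  P (it k w) - P (it k.+1 w) + gam k * (1 + c ^+ 2 / 2) * sq_error k w +
  gam k / (2 * c ^+ 2) * sq_residual k w.
Proof.
move=> c0; rewrite (iterateS game gam S xi px0) sq_residualE sq_sample_residualE.
exact: (sample_residual_descent X_closed X_convex f_P P_smooth f_diff L_gt0
  (gam_gt0 k) (px k w)).
Qed.

Lemma sum_descent (c : R) w : 0 < c ->
  \sum_(k < K) weight k.+1 * sq_sample_residual k.+1 w <=
  (Pmax - Pmin) + \sum_(k < K) (gam k.+1 * (1 + c ^+ 2 / 2)) * sq_error k.+1 w +
  \sum_(k < K) (weight k.+1 / c ^+ 2) * sq_residual k.+1 w.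
Proof.
move=> c0.
have le_k k : weight k * sq_sample_residual k w <=
    P (it k w) - P (it k.+1 w) + gam k * (1 + c ^+ 2 / 2) * sq_error k w +
    weight k / c ^+ 2 * sq_residual k w.
  apply: (le_trans (step_descent k w c0)); rewrite lerD2l.
  rewrite ler_wpM2r ?sqr_ge0// invfM mulrA ler_wpM2r ?half_le_weight//.
  by rewrite invr_ge0 sqr_ge0.
apply: (le_trans (le_sum_telescope le_k K)); rewrite !lerD2r.
by rewrite lerB//; [exact: P_le|exact: P_ge].
Qed.

Local Notation W := (\sum_(1 <= j < K.+1) (gam j - L * gam j ^+ 2)).

Lemma sum_weight_gt0 : 0 < W.
Proof.
have [_ K0 _ _ _] := run.
rewrite big_add1 big_mkord/= -(prednK K0) big_ord_recl ltr_wpDr ?weight_gt0//.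
by apply: sumr_ge0 => k _; exact/ltW/weight_gt0.
Qed.

Let pmf k : (1 <= k <= K)%N -> Pr (Rk @^-1` [set k]) = (weight k / W)%:E.
Proof. by have [_ _ _ _ [_ _ + _ _]] := run; exact. Qed.

Let sum_pmf : \sum_(1 <= k < K.+1) weight k / W = 1.
Proof. by rewrite -mulr_suml divff// gt_eqF// sum_weight_gt0. Qed.

Let Rk_indep : mutually_independent Pr
  (fun b : bool => if b then g_sigma_algebra_preimage Rk else past S xi K.+1).
Proof. by have [_ _ _ _ []] := run. Qed.

Lemma expectation_index (phi : nat -> Omega -> R) (A : nat -> R) :
  (forall k w, 0 <= phi k w) -> (forall k, measurable_fun setT (phi k)) ->
  (forall k B, (k <= K)%N -> measurable B -> past S xi K.+1 (phi k @^-1` B)) ->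
  (forall k, (k <= K)%N -> (\int[Pr]_w (phi k w)%:E)%E = (A k)%:E) ->
  'E_Pr[fun w => phi (Rk w) w]%E = ((\sum_(1 <= k < K.+1) weight k * A k) / W)%:E.
Proof.
move=> phi0 mphi phi_past phiA.
rewrite (expectation_random_index Rk_indep pmf sum_pmf phi0 mphi) => [|k /andP[_ kK] B]; last first.
  exact: phi_past.
rewrite mulr_suml -sumEFin !big_nat; apply: eq_bigr => k /andP[_ kK].
by rewrite phiA// [in RHS]mulrAC.
Qed.

(** A k and B k are the mean squares of the sampled and exact residuals at a fixed index. As they
    are finite, both parts of the theorem reduce to real arithmetic on these four facts. *)
Lemma mean_residuals : exists A B : nat -> R,
  [/\ mean_sq_sample_residual X ft x0 gam S xi Rk =
        ((\sum_(1 <= k < K.+1) weight k * A k) / W)%:E,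
      mean_sq_residual X ft x0 gam S xi f Rk =
        ((\sum_(1 <= k < K.+1) weight k * B k) / W)%:E,
      forall c, 0 < c -> \sum_(1 <= k < K.+1) weight k * A k <=
        (Pmax - Pmin) + \sum_(1 <= k < K.+1) gam k * (1 + c ^+ 2 / 2) * error_bound k +
        \sum_(1 <= k < K.+1) weight k / c ^+ 2 * B k &
      forall k, (k <= K)%N -> B k <= 2 * A k + 2 * error_bound k].
Proof.
have [A AE] : exists A : nat -> R, forall k, (k <= K)%N ->
    (\int[Pr]_w (sq_sample_residual k w)%:E)%E = (A k)%:E.
  exists (fun k => fine (\int[Pr]_w (sq_sample_residual k w)%:E)%E) => k kK; rewrite fineK//.
  by have := integrable_fin_num measurableT (integrable_sq_sample_residual kK).
have [B BE] : exists B : nat -> R, forall k,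
    (\int[Pr]_w (sq_residual k w)%:E)%E = (B k)%:E.
  exists (fun k => fine (\int[Pr]_w (sq_residual k w)%:E)%E) => k; rewrite fineK//.
  by have := integrable_fin_num measurableT (integrable_sq_residual k).
have [V VE] : exists V : nat -> R, forall k, (k <= K)%N ->
    (\int[Pr]_w (sq_error k w)%:E)%E = (V k)%:E.
  exists (fun k => fine (\int[Pr]_w (sq_error k w)%:E)%E) => k kK; rewrite fineK//.
  by have := integrable_fin_num measurableT (integrable_sq_error kK).1.
have V_le k : (k <= K)%N -> V k <= error_bound k.
  by move=> kK; rewrite -lee_fin -VE//; exact: (integrable_sq_error kK).2.
exists A, B; split.
- apply: (expectation_index (phi := sq_sample_residual)).
  + by move=> k w; exact: sqr_ge0.
  + exact: measurable_sq_sample_residual.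
  + by move=> *; exact: past_sq_sample_residual.
  + exact: AE.
- apply: (expectation_index (phi := sq_residual)).
  + by move=> k w; exact: sqr_ge0.
  + exact: measurable_sq_residual.
  + by move=> *; exact: past_sq_residual.
  + by move=> k _; exact: BE.
- move=> c c0.
  have E (g : nat -> R) : \sum_(1 <= k < K.+1) g k = \sum_(k < K) g k.+1.
    by rewrite big_add1 big_mkord.
  rewrite (E (fun k => weight k * A k)) (E (fun k => weight k / c ^+ 2 * B k)).
  rewrite (E (fun k => gam k * (1 + c ^+ 2 / 2) * error_bound k)).
  have kK (k : 'I_K) : (k.+1 <= K)%N by [].
  have H := le_sum_integral (fun k => integrable_sq_sample_residual (kK k))
    (fun k => (integrable_sq_error (kK k)).1)
    (fun k : 'I_K => integrable_sq_residual k.+1) (fun k => AE _ (kK k))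
    (fun k => VE _ (kK k)) (fun k : 'I_K => BE k.+1) (fun w => sum_descent w c0).
  apply: (le_trans H); rewrite lerD2r lerD2l; apply: ler_sum => k _.
  rewrite ler_wpM2l ?V_le// mulr_ge0 ?ltW// ltr_wpDr// divr_ge0//.
  exact: sqr_ge0.
move=> k kK; apply: (@le_trans _ _ (2 * A k + 2 * V k)); last first.
  by rewrite lerD2l ler_wpM2l// V_le.
apply: (le_integral_comb (integrable_sq_residual k) (integrable_sq_sample_residual kK)
  (integrable_sq_error kK).1 (BE k) (AE k kK) (VE k kK)) => w.
by have [] := sq_residual_triangle k w.
Qed.

Lemma mean_sq_sample_residual_le (c : R) : 0 < c ->
  (mean_sq_sample_residual X ft x0 gam S xi Rk <=
   ((2 * (Pmax - Pmin) +
     (2 + c ^+ 2) * N%:R *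
       \sum_(1 <= k < K.+1) gam k *
          ((sigma k ^+ 2 + ((S k)%:R - 1) * mu k ^+ 2) / (S k)%:R)) /
    (2 * W))%:E + (1 / c ^+ 2)%:E * mean_sq_residual X ft x0 gam S xi f Rk)%E.
Proof.
move=> c0; have [A [B [-> -> /(_ c c0) le_AB _]]] := mean_residuals.
have W0 := sum_weight_gt0.
rewrite -EFinM -EFinD lee_fin ler_pdivrMr//.
have -> : (((2 * (Pmax - Pmin) + (2 + c ^+ 2) * N%:R *
       \sum_(1 <= k < K.+1) gam k *
          ((sigma k ^+ 2 + ((S k)%:R - 1) * mu k ^+ 2) / (S k)%:R)) / (2 * W) +
    1 / c ^+ 2 * ((\sum_(1 <= k < K.+1) weight k * B k) / W)) * W) =
  (Pmax - Pmin) + (1 + c ^+ 2 / 2) * (N%:R * \sum_(1 <= k < K.+1) gam k *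
          ((sigma k ^+ 2 + ((S k)%:R - 1) * mu k ^+ 2) / (S k)%:R)) +
  (\sum_(1 <= k < K.+1) weight k * B k) / c ^+ 2.
  move: (\sum_(1 <= k < K.+1) _ * _) (\sum_(1 <= k < K.+1) _ * _) W W0 => U V W' W0.
  by field; rewrite !gt_eqF.
apply: (le_trans le_AB); rewrite le_eqVlt; apply/orP; left; apply/eqP.
congr (_ + _ + _).
  rewrite !mulr_sumr; apply: eq_bigr => k _; rewrite /error_bound.
  by move: (_ / (S k)%:R) => e; ring.
by rewrite mulr_suml; apply: eq_bigr => k _; rewrite mulrAC.
Qed.

Lemma mean_sq_residual_le (c sbar : R) (Sbar : nat) : 0 < c ->
  (forall k, (1 <= k <= K)%N -> gam k = 1 / (2 * L)) ->
  (forall k, S k = Sbar) ->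
  (forall k, (k <= K)%N -> sigma k <= sbar) ->
  exists2 B : R, mean_sq_residual X ft x0 gam S xi f Rk = B%:E &
    (1 - 2 / c ^+ 2) * B <= 8 * (L * (Pmax - Pmin)) / K%:R +
      (6 + 2 * c ^+ 2) * N%:R *
        (sbar ^+ 2 / Sbar%:R + (\sum_(1 <= k < K.+1) mu k ^+ 2) / K%:R).
Proof.
move=> c0 gamE SE sigma_le.
have [_ K0 _ S0 [_ _ _ _ sigma0]] := run.
have [A [B [_ -> /(_ c c0) le_AB le_BA]]] := mean_residuals.
eexists; first reflexivity.
have Sb0 : 0 < Sbar%:R :> R by rewrite -(SE 0%N) ltr0n S0.
have Sb1 : 1 <= Sbar%:R :> R by rewrite ler1n -(SE 0%N) S0.
have K0' : 0 < K%:R :> R by rewrite ltr0n.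
have weightE k : (1 <= k <= K)%N -> weight k = 1 / (4 * L).
  by move=> /gamE gk; rewrite /weight gk; field; rewrite gt_eqF.
have WE : W = K%:R / (4 * L).
  rewrite (eq_big_nat _ _ (F2 := fun=> 1 / (4 * L))); last first.
    by move=> k /andP[k1 kK]; apply: weightE; rewrite k1.
  by rewrite sumr_const_nat subSS subn0 -[LHS]mulr_natl mul1r.
set M2 := \sum_(1 <= k < K.+1) mu k ^+ 2.
pose Q := \sum_(1 <= k < K.+1) error_bound k.
(* Here (S - 1) / S <= 1 leaves the bias as mu^2. *)
have Q_le : Q <= N%:R * (K%:R * (sbar ^+ 2 / Sbar%:R) + M2).
  have -> : N%:R * (K%:R * (sbar ^+ 2 / Sbar%:R) + M2) =
      \sum_(1 <= k < K.+1) N%:R * (sbar ^+ 2 / Sbar%:R + mu k ^+ 2).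
    by rewrite -mulr_sumr big_split/= sumr_const_nat subSS subn0 -[X in _ = _ * (X + _)]mulr_natl.
  apply: ler_sum_nat => k /andP[_ kK].
  have [sk _] := sigma0 k kK.
  rewrite /error_bound ler_wpM2l// SE mulrDl; apply: lerD.
    rewrite ler_pM2r ?invr_gt0// ler_sqr ?nnegrE ?(ltW sk) ?sigma_le//.
    exact: le_trans (ltW sk) (sigma_le k kK).
  by rewrite ler_pdivrMr// mulrC ler_wpM2l ?sqr_ge0// gerBl.
have le1 : \sum_(1 <= k < K.+1) weight k * B k <=
    2 * (\sum_(1 <= k < K.+1) weight k * A k) + 1 / (2 * L) * Q.
  rewrite /Q !mulr_sumr -big_split/=; apply: ler_sum_nat => k /andP[k1 kK].
  have := ler_wpM2l (ltW (weight_gt0 k)) (le_BA k kK).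
  rewrite mulrDr [weight k * (2 * error_bound k)]mulrA (weightE k) ?k1//.
  have -> : 1 / (4 * L) * 2 = 1 / (2 * L) by field; rewrite gt_eqF.
  by rewrite [in X in X -> _](mulrCA _ 2).
have le2 : \sum_(1 <= k < K.+1) weight k * A k <=
    (Pmax - Pmin) + (1 + c ^+ 2 / 2) / (2 * L) * Q +
    (\sum_(1 <= k < K.+1) weight k * B k) / c ^+ 2.
  apply: (le_trans le_AB); rewrite le_eqVlt; apply/orP; left; apply/eqP.
  congr (_ + _ + _); last by rewrite mulr_suml; apply: eq_bigr => k _; rewrite mulrAC.
  rewrite /Q mulr_sumr; apply: eq_big_nat => k /gamE ->.
  by rewrite mulrC mul1r [_ / (2 * L)]mulrC mulrC.
rewrite WE; move: le1 le2 Q_le.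
move: (\sum_(1 <= k < K.+1) weight k * A k) (\sum_(1 <= k < K.+1) weight k * B k) Q M2.
move=> SA SB Q M2.
move=> le1 le2 Q_le.
have c20 : 0 < c ^+ 2 by rewrite exprn_gt0.
(* Inserting [le2] into [le1] doubles its terms: 3 + c^2 = 2 (1 + c^2 / 2) + 1, and SB / c^2 counted
   twice moves to the left. *)
have le3 : (1 - 2 / c ^+ 2) * SB <= 2 * (Pmax - Pmin) + (3 + c ^+ 2) / (2 * L) * Q.
  have -> : (3 + c ^+ 2) / (2 * L) * Q = 2 * ((1 + c ^+ 2 / 2) / (2 * L) * Q) + 1 / (2 * L) * Q.
    by field; rewrite gt_eqF.
  have -> : (1 - 2 / c ^+ 2) * SB = SB - 2 * (SB / c ^+ 2) by field; rewrite gt_eqF.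
  by move: ((1 + _) / _ * Q) (1 / _ * Q) (SB / _) le1 le2 => u v z; lra.
have -> : (1 - 2 / c ^+ 2) * (SB / (K%:R / (4 * L))) = ((1 - 2 / c ^+ 2) * SB) * (4 * L / K%:R).
  by field; rewrite !gt_eqF.
apply: (@le_trans _ _ ((2 * (Pmax - Pmin) + (3 + c ^+ 2) / (2 * L) * Q) * (4 * L / K%:R))).
  by rewrite ler_pM2r// divr_gt0// mulr_gt0.
have -> : (2 * (Pmax - Pmin) + (3 + c ^+ 2) / (2 * L) * Q) * (4 * L / K%:R) =
    8 * (L * (Pmax - Pmin)) / K%:R + (6 + 2 * c ^+ 2) / K%:R * Q.
  by field; rewrite !gt_eqF.
rewrite lerD2l.
have -> : (6 + 2 * c ^+ 2) * N%:R * (sbar ^+ 2 / Sbar%:R + M2 / K%:R) =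
    (6 + 2 * c ^+ 2) / K%:R * (N%:R * (K%:R * (sbar ^+ 2 / Sbar%:R) + M2)).
  by field; rewrite !gt_eqF.
rewrite ler_wpM2l// divr_ge0 ?ler0n//; apply: addr_ge0 => //.
by apply: mulr_ge0 => //; exact: ltW.
Qed.

End Run.

(** * Choice of the batch size *)

Section BatchSize.
Context {R : realType}.
Implicit Types (a s N S T : R).

(* For s = sqrt M large, rounding a * s up to S and s^2 / (N * S) down to T costs at most a
   factor 2. *)
Lemma iteration_count_ge a s N S T : 0 < a -> 0 < N ->
  (1 + 2 * N * a ^+ 2 + 2 * N * a) / a + 1 <= s -> S <= a * s + 1 ->
  s ^+ 2 < (T + 1) * (N * S) -> 0 <= T -> s <= 2 * N * a * T.
Proof.
move=> a0 N0 s_large S_le T_gt T0; rewrite leNgt; apply/negP => T_lt.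
have Na : 0 < N * a by rewrite mulr_gt0.
have Naa : 0 < N * a ^+ 2 by rewrite mulr_gt0// exprn_gt0.
have s1 : 1 <= s.
  apply: le_trans s_large; rewrite lerDr divr_ge0 ?(ltW a0)//; lra.
have as_ge : 1 + 2 * N * a ^+ 2 + 2 * N * a <= a * s.
  rewrite (mulrC a s) -ler_pdivrMr//; apply: le_trans s_large; by rewrite lerDl ler01.
have h1 : (T + 1) * (N * S) <= (T + 1) * (N * (a * s + 1)).
  by rewrite ler_wpM2l ?addr_ge0// ler_wpM2l// ltW.
have h2 : 2 * a * ((T + 1) * (N * (a * s + 1))) <= (s + 2 * N * a) * (a * s + 1).
  have -> : 2 * a * ((T + 1) * (N * (a * s + 1))) =
      (2 * N * a * T + 2 * N * a) * (a * s + 1) by ring.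
  rewrite ler_wpM2r//; last by rewrite lerD2r ltW.
  by rewrite addr_ge0// mulr_ge0 ?(ltW a0)//; lra.
have h3 : s * (1 + 2 * N * a ^+ 2 + 2 * N * a) <= s * (a * s).
  by rewrite ler_wpM2l//; lra.
have h4 : 2 * N * a <= s * (2 * N * a).
  by rewrite ler_peMl//; lra.
have h5 : 2 * a * s ^+ 2 < 2 * a * ((T + 1) * (N * S)) by rewrite ltr_pM2l// mulr_gt0.
have h6 : 2 * a * ((T + 1) * (N * S)) <= 2 * a * ((T + 1) * (N * (a * s + 1))).
  by rewrite ler_wpM2l// mulr_ge0// ltW.
(* This expands to a s^2 < s (1 + 2 N a^2) + 2 N a, which [h3] and [h4] contradict: the threshold on
   s is made for them. *)
have := lt_le_trans h5 (le_trans h6 h2).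
clear - h3 h4.
rewrite !expr2; nra.
Qed.

(** With s = sqrt M and S close to a s, the variance term is of order 1 / (a s) and 1 / T of order N
    a / s: the batch size brings both to order 1 / sqrt M. *)
Lemma batch_arith (L D sbar N s S T M2 c2 : R) : 0 < L -> 0 < D -> 0 < sbar -> 0 < N ->
  0 < s -> 0 < T -> 0 <= M2 -> 0 <= c2 ->
  sbar * Num.sqrt 6 / (4 * L * D) * s <= S ->
  s <= 2 * N * (sbar * Num.sqrt 6 / (4 * L * D)) * T ->
  8 * (L ^+ 2 * D ^+ 2) / T + (6 + 2 * c2) * N * (sbar ^+ 2 / S + M2 / T) <=
  (4 / 3 * Num.sqrt 6 * (9 + 2 * c2) * L ^+ 2 * D ^+ 2 * N * sbar +
   Num.sqrt 6 * (3 + c2) * N ^+ 2 * sbar * M2) / (L * D * s).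
Proof.
move=> L0 D0 sb0 N0 s0 T0 M20 c20.
have : 0 < Num.sqrt 6 :> R by rewrite sqrtr_gt0.
have : Num.sqrt 6 ^+ 2 = 6 :> R by rewrite sqr_sqrtr.
move: (Num.sqrt 6) => q q2 q0.
set a := sbar * q / (4 * L * D) => aS sT.
have a0 : 0 < a by rewrite divr_gt0 ?mulr_gt0.
have S0 : 0 < S by apply: lt_le_trans aS; rewrite mulr_gt0.
have invT : T^-1 <= 2 * N * a / s.
  by rewrite ler_pdivlMr// mulrC ler_pdivrMr.
have invS : sbar ^+ 2 / S <= sbar ^+ 2 / (a * s).
  by rewrite ler_pM2l ?exprn_gt0// lef_pV2 ?posrE// mulr_gt0.
have E : sbar ^+ 2 / (a * s) = 2 / 3 * q * sbar * (L * D) / s.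
  have -> : sbar ^+ 2 / (a * s) = 4 * sbar * (L * D) / (q * s).
    by rewrite /a; field; rewrite !gt_eqF.
  have -> : 4 * sbar * (L * D) / (q * s) = (4 * q * sbar * (L * D)) / (q ^+ 2 * s).
    by field; rewrite !gt_eqF.
  by rewrite q2; field; rewrite gt_eqF.
have E2 : 2 * N * a / s = N * sbar * q / (2 * (L * D) * s).
  by rewrite /a; field; rewrite !gt_eqF.
rewrite E in invS; rewrite E2 in invT.
apply: (@le_trans _ _ (8 * (L ^+ 2 * D ^+ 2) * (N * sbar * q / (2 * (L * D) * s)) +
  (6 + 2 * c2) * N * (2 / 3 * q * sbar * (L * D) / s + M2 * (N * sbar * q / (2 * (L * D) * s))))).
  apply: lerD; first by rewrite ler_wpM2l// !mulr_ge0 ?exprn_ge0 ?ltW.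
  rewrite ler_wpM2l//; first by rewrite mulr_ge0 ?ltW// ltr_wpDr// mulr_ge0.
  by apply: lerD => //; rewrite ler_wpM2l.
rewrite -subr_ge0.
(* The terms in M2 cancel exactly; in the others 12 + (8/3) c2 stands against 8 + (4/3) c2. *)
have -> : (4 / 3 * q * (9 + 2 * c2) * L ^+ 2 * D ^+ 2 * N * sbar +
   q * (3 + c2) * N ^+ 2 * sbar * M2) / (L * D * s) -
  (8 * (L ^+ 2 * D ^+ 2) * (N * sbar * q / (2 * (L * D) * s)) +
  (6 + 2 * c2) * N * (2 / 3 * q * sbar * (L * D) / s + M2 * (N * sbar * q / (2 * (L * D) * s)))) =
  (4 + 4 / 3 * c2) * (q * (L * D) * N * sbar / s).
  by field; rewrite !gt_eqF.
apply: mulr_ge0; first by rewrite addr_ge0// mulr_ge0.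
by apply/ltW; rewrite divr_gt0// !mulr_gt0.
Qed.

End BatchSize.

Theorem theorem3p2 (R : realType) (N : nat) (n : 'I_N -> nat) (p : nat)
  (X : forall i : 'I_N, set 'rV[R]_(n i))
  (nu : probability (borel_rV R p) R)
  (ft : 'I_N -> 'rV[R]_(\sum_(i < N) n i) -> 'rV[R]_p -> R)
  (P : 'rV[R]_(\sum_(i < N) n i) -> R) (L Pmax Pmin : R)
  (N_gt0 : (0 < N)%N)
  (game : stochastic_game X ft nu)
  (L_gt0 : 0 < L)
  (P_potential : is_potential X (objective ft nu) P)
  (P_smooth : smooth_on (profiles X) L P)
  (P_max : exists2 x, profiles X x & P x = Pmax /\
             forall y, profiles X y -> P y <= Pmax)
  (P_min : exists2 x, profiles X x & P x = Pmin /\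
             forall y, profiles X y -> Pmin <= P y) :
  let D := Num.sqrt ((Pmax - Pmin) / L) in
  let f := objective ft nu in
  (forall (d : measure_display) (Omega : measurableType d)
      (Pr : probability Omega R)
      (x0 : 'rV[R]_(\sum_(i < N) n i)) (gam : nat -> R) (S : nat -> nat)
      (xi : nat -> 'I_N -> nat -> {RV Pr >-> borel_rV R p})
      (mu sigma : nat -> R) (T : nat) (Rk : {RV Pr >-> nat}) (c : R),
    rsg_run X ft x0 gam S xi nu L T mu sigma Rk ->
    0 < c ->
    (mean_sq_sample_residual X ft x0 gam S xi Rk <=
     ((2 * L * D ^+ 2 +
       (2 + c ^+ 2) * N%:R *
         \sum_(1 <= k < T.+1) gam k *
            ((sigma k ^+ 2 + ((S k)%:R - 1) * mu k ^+ 2) / (S k)%:R)) /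
      (2 * \sum_(1 <= k < T.+1) (gam k - L * gam k ^+ 2)))%:E +
     (1 / c ^+ 2)%:E * mean_sq_residual X ft x0 gam S xi f Rk)%E) /\
  (forall sbar : R, 0 < sbar ->
    exists M0 : nat, forall M : nat, (M0 <= M)%N ->
    forall (d : measure_display) (Omega : measurableType d)
      (Pr : probability Omega R)
      (x0 : 'rV[R]_(\sum_(i < N) n i)) (gam : nat -> R) (S : nat -> nat)
      (xi : nat -> 'I_N -> nat -> {RV Pr >-> borel_rV R p})
      (mu sigma : nat -> R) (Sbar T : nat) (Rk : {RV Pr >-> nat}),
    Sbar%:Z = Num.ceil (sbar * Num.sqrt (6 * M%:R) / (4 * L * D)) ->
    (forall k, S k = Sbar) ->
    T = (M %/ (N * Sbar))%N ->
    rsg_run X ft x0 gam S xi nu L T mu sigma Rk ->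
    (forall k, (1 <= k <= T)%N ->
       gam k = 1 / (2 * L) /\ Pr (Rk @^-1` [set k]) = (1 / T%:R)%:E) ->
    (forall k, (k <= T)%N -> sigma k <= sbar) ->
    (forall c : R, Num.sqrt 2 < c ->
      (mean_sq_residual X ft x0 gam S xi f Rk <=
       ((16 * L ^+ 2 * D ^+ 2 * N%:R) / ((1 - 2 / c ^+ 2) * M%:R) +
        (4 / 3 * Num.sqrt 6 * (9 + 2 * c ^+ 2) * L ^+ 2 * D ^+ 2 * N%:R * sbar +
         Num.sqrt 6 * (3 + c ^+ 2) * N%:R ^+ 2 * sbar *
           \sum_(1 <= k < T.+1) mu k ^+ 2) /
        ((1 - 2 / c ^+ 2) * L * D * Num.sqrt M%:R))%:E)%E) /\
    (mean_sq_residual X ft x0 gam S xi f Rk <=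
     ((48 * L ^+ 2 * D ^+ 2 * N%:R) / M%:R +
      (60 * Num.sqrt 6 * L ^+ 2 * D ^+ 2 * N%:R * sbar +
       18 * Num.sqrt 6 * N%:R ^+ 2 * sbar *
         \sum_(1 <= k < T.+1) mu k ^+ 2) /
      (L * D * Num.sqrt M%:R))%:E)%E).
Proof.
move=> D f; have [xmax _ [_ P_le]] := P_max; have [xmin pmin [Pmin_eq P_ge]] := P_min.
have PP : 0 <= Pmax - Pmin by rewrite subr_ge0 -Pmin_eq P_le.
have D2 : L * D ^+ 2 = Pmax - Pmin.
  by rewrite /D sqr_sqrtr ?divr_ge0 ?(ltW L_gt0)// mulrC divfK// gt_eqF.
split=> [d Omega Pr x0 gam S xi mu sigma T Rk c run c0|sbar sb0].
  have := mean_sq_sample_residual_le game L_gt0 P_potential P_smooth P_le P_ge run c0.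
  by rewrite -D2 mulrA.
have [a aE] : exists a, a = sbar * Num.sqrt 6 / (4 * L * D) by eexists.
pose s0 := (1 + 2 * N%:R * a ^+ 2 + 2 * N%:R * a) / a + 1.
(* The threshold makes sqrt M >= s0; it depends on the game and on [sbar], not on the run. *)
exists (Num.bound (s0 ^+ 2)) => M M_large d Omega Pr x0 gam S xi mu sigma Sbar T Rk.
move=> SbarE SE TE run gamE sigma_le.
have [_ T0 _ S0 _] := run.
(* If D were 0, the quotient defining the batch size would be a division by zero, of value 0, and
   the batch would be empty. *)
have D0 : 0 < D.
  rewrite lt_neqAle sqrtr_ge0 andbT; apply/eqP => D0.
  move: SbarE; rewrite -D0 mulr0 invr0 mulr0 ceil0 => -[Sb0].
  by have := S0 0%N; rewrite SE Sb0.
have N0 : 0 < N%:R :> R by rewrite ltr0n.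
have q0 : 0 < Num.sqrt 6 :> R by rewrite sqrtr_gt0.
have a0 : 0 < a by rewrite aE; apply: divr_gt0; rewrite !mulr_gt0.
have s00 : 0 < s0.
  apply: ltr_wpDl => //; apply: divr_ge0; last exact: ltW.
  by rewrite !addr_ge0// !mulr_ge0 ?exprn_ge0// ltW.
have s0M : s0 ^+ 2 <= M%:R.
  by apply: (le_trans (ltW (archi_boundP (sqr_ge0 s0)))); rewrite ler_nat.
set s := Num.sqrt M%:R.
have s2 : s ^+ 2 = M%:R by rewrite sqr_sqrtr.
have s0s : s0 <= s by rewrite -ler_sqr ?nnegrE ?sqrtr_ge0 ?(ltW s00)// s2.
have s_gt0 : 0 < s := lt_le_trans s00 s0s.
have SbarR : Sbar%:R = (Num.ceil (a * s))%:~R :> R.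
  rewrite (_ : a * s = sbar * Num.sqrt (6 * M%:R) / (4 * L * D)) -?SbarE//.
  by rewrite aE sqrtrM// mulrAC mulrA.
have aS : a * s <= Sbar%:R by rewrite SbarR ceil_ge.
have Sa : Sbar%:R <= a * s + 1.
  by rewrite SbarR -lerBlDr ltW// -[1 in X in X < _]/(1%:~R) -intrB ceilB1_lt.
have sT : s <= 2 * N%:R * a * T%:R.
  apply: (iteration_count_ge (S := Sbar%:R)) => //.
  (* T is the integer part of M / (N * Sbar), so M < (T + 1) * N * Sbar. *)
  rewrite s2 natr1 -!natrM ltr_nat TE ltn_ceil// muln_gt0 N_gt0.
  by rewrite -(SE 0%N) S0.
have TR0 : 0 < T%:R :> R by rewrite ltr0n.
have main c : Num.sqrt 2 < c ->
  (mean_sq_residual X ft x0 gam S xi f Rk <=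
       ((16 * L ^+ 2 * D ^+ 2 * N%:R) / ((1 - 2 / c ^+ 2) * M%:R) +
        (4 / 3 * Num.sqrt 6 * (9 + 2 * c ^+ 2) * L ^+ 2 * D ^+ 2 * N%:R * sbar +
         Num.sqrt 6 * (3 + c ^+ 2) * N%:R ^+ 2 * sbar *
           \sum_(1 <= k < T.+1) mu k ^+ 2) /
        ((1 - 2 / c ^+ 2) * L * D * s))%:E)%E.
  move=> c_gt; have c0 : 0 < c by rewrite (le_lt_trans (sqrtr_ge0 _) c_gt).
  have c2 : 2 < c ^+ 2.
    by rewrite -[X in X < _](@sqr_sqrtr _ 2)// ltr_sqr ?nnegrE ?sqrtr_ge0 ?(ltW c0).
  have c20 : 0 < c ^+ 2 by rewrite exprn_gt0.
  set k := 1 - 2 / c ^+ 2.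
  have k0 : 0 < k by rewrite subr_gt0 ltr_pdivrMr// mul1r.
  have gamE' j : (1 <= j <= T)%N -> gam j = 1 / (2 * L) by move=> /gamE[].
  have [B -> le_B] := mean_sq_residual_le game L_gt0 P_potential P_smooth P_le P_ge run
    c0 gamE' SE sigma_le.
  set M2 := \sum_(1 <= j < T.+1) mu j ^+ 2 in le_B *; rewrite -/k in le_B.
  have M20 : 0 <= M2 by apply: sumr_ge0 => j _; exact: sqr_ge0.
  have := batch_arith L_gt0 D0 sb0 N0 s_gt0 TR0 M20 (ltW c20).
  rewrite -aE => /(_ _ aS sT).
  have -> : L ^+ 2 * D ^+ 2 = L * (Pmax - Pmin) by rewrite -D2; ring.
  move=> /(le_trans le_B); set Y := _ + _ => kB.
  have M0 : 0 < M%:R :> R by rewrite -s2 exprn_gt0.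
  (* The estimate [kB] fits in the term in 1 / sqrt M; the term in 1 / M is nonnegative and enlarges
     the bound. *)
  rewrite lee_fin (_ : _ + _ = (16 * L ^+ 2 * D ^+ 2 * N%:R / M%:R + Y / (L * D * s)) / k).
    rewrite ler_pdivlMr// mulrC (le_trans kB)// lerDr.
    by rewrite divr_ge0 ?ltW// !mulr_gt0 ?exprn_gt0.
  by field; rewrite !gt_eqF.
split; first exact: main.
have lt23 : Num.sqrt 2 < Num.sqrt 3 :> R by rewrite ltr_sqrt// ltr_nat.
(* For c^2 = 3 one has 1 - 2 / c^2 = 1/3, and 48 = 3 * 16, 60 = 3 * (4/3) * 15, 18 = 3 * 6 are
   exact. *)
apply: (le_trans (main _ lt23)); rewrite lee_fin le_eqVlt; apply/orP; left; apply/eqP.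
rewrite sqr_sqrtr//; move: (Num.sqrt 6) (\sum_(1 <= k < T.+1) _) => q M2.
have M0 : 0 < M%:R :> R by rewrite -s2 exprn_gt0.
by rewrite -/s; field; rewrite !gt_eqF.
Qed.
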